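(* Let $n\ge 2$ and regard the special algebra $S(n)$ as a $W(1)$-module via $x\cdot D=[\Theta_S(x),D]$, where $\Theta_S(x_1^i\partial_1)=x_1^i\partial_1-ix_1^{i-1}x_2\partial_2$. Then $$S(n)\cong V(0)^{\oplus((n-1)(p^{n-2}-1)+1)}\oplus V(p-1)^{\oplus((n-1)p^{n-2}-1)}\oplus\Big(\bigoplus_{i=1}^{p-2}L(i)^{\oplus(n-1)p^{n-2}}\Big)\oplus L(p-1)^{\oplus(n-1)}.$$
   Context: $\mathbb F$ is an algebraically closed field of characteristic $p>2$, $I=\{0,\dots,p-1\}$. $\mathcal A(n)$ is the truncated polynomial algebra with basis $x_1^{a_1}\cdots x_n^{a_n}$, $a_i\in I$, with $x^\alpha x^\beta=x^{\alpha+\beta}$ ($=0$ if some exponent exceeds $p-1$); $W(n)=\mathrm{Der}\,\mathcal A(n)$, free on $\partial_i$ with $\partial_i(x_j)=\delta_{ij}$; $S(n)=[\widetilde S(n),\widetilde S(n)]$ where $\widetilde S(n)=\{\sum f_i\partial_i\in W(n)\mid\sum\partial_i(f_i)=0\}$. $W(1)$ is the Witt algebra with basis $x_1^i\partial_1$, $i\in I$; $W(1)_{[i]}=\mathbb Fx_1^{i+1}\partial_1$, $W(1)_0=\bigoplus_{i\ge0}W(1)_{[i]}$, $W(1)_1=\bigoplus_{i\ge1}W(1)_{[i]}$. For $\lambda\in I$, $\mathbb F_\lambda$ is the one-dimensional $W(1)_0$-module with $x_1\partial_1$ acting by $\lambda$ and $W(1)_1$ by $0$; $V(\lambda)=u(W(1))\otimes_{u(W(1)_0)}\mathbb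 F_\lambda$ ($u$ = restricted enveloping algebra) is the restricted baby Verma module and $L(\lambda)$ its unique simple quotient. *)

(* Defs.v *)
From HB Require Import structures.
From mathcomp Require Import all_boot all_order all_algebra.
Set Implicit Arguments. Unset Strict Implicit. Unset Printing Implicit Defensive.
Import Order.TTheory GRing.Theory.
Local Open Scope ring_scope.

(* Exponent vectors alpha in I^n, I = {0,...,p-1}. *)
Notation mon p n := {ffun 'I_n -> 'I_p}.
(* A(n): truncated polynomial algebra, an element = its coefficient function
   on the monomial basis x^alpha.  NB: the ring structure that MathComp puts
   on ffuns is pointwise and is NOT used; the product of A(n) is [mulA]. *)
Notation Alg F p n := {ffun mon p n -> F^o}.
(* W(n) = Der A(n), free on d_1..d_n : D = sum_i D i d_i. *)
Notation Wn F p n := {ffun 'I_n -> Alg F p n}.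

Section Witt.
Variables (F : fieldType) (p : nat).

(* x^alpha x^beta = x^(alpha+beta), or 0 if some exponent exceeds p-1 *)
Definition mulA n (f g : Alg F p n) : Alg F p n :=
  [ffun gam : mon p n => \sum_(al : mon p n) \sum_(be : mon p n)
     (if [forall k, ((al k : nat) + be k)%N == gam k] then f al * g be else 0)].

(* monomial x^e for an exponent function e (0 if e is out of range) *)
Definition monoA n (e : 'I_n -> nat) : Alg F p n :=
  [ffun al : mon p n => if [forall k, (al k : nat) == e k] then 1 else 0].

Definition varA n (j : 'I_n) : Alg F p n := monoA (fun k => nat_of_bool (k == j)).

(* partial derivative d_i (x^alpha) = alpha_i x^(alpha - e_i) *)
Definition derA n (i : 'I_n) (f : Alg F p n) : Alg F p n :=
  [ffun gam : mon p n => \sum_(al : mon p n)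
     (if ((al i : nat) == (gam i).+1) && [forall k, (k != i) ==> (al k == gam k)]
      then (al i)%:R * f al else 0)].

Definition applyD n (D : Wn F p n) (f : Alg F p n) : Alg F p n :=
  \sum_(i < n) mulA (D i) (derA i f).

Definition brW n (D E : Wn F p n) : Wn F p n :=
  [ffun j : 'I_n => applyD D (E j) - applyD E (D j)].

Definition divW n (D : Wn F p n) : Alg F p n := \sum_(i < n) derA i (D i).
Definition Stilde n (D : Wn F p n) : Prop := divW D = 0.
Definition Sn n (D : Wn F p n) : Prop :=
  exists (m : nat) (c : 'I_m -> F) (a b : 'I_m -> Wn F p n),
    (forall k, Stilde (a k) /\ Stilde (b k)) /\
    D = \sum_(k < m) c k *: brW (a k) (b k).

(* p-map of the restricted Lie algebra W(n): D^[p] = D^p (as derivation),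
   determined by its values on the generators x_j *)
Definition pmapW n (D : Wn F p n) : Wn F p n :=
  [ffun j : 'I_n => iter p (applyD D) (varA j)].

Definition xdW1 : Wn F p 1 :=
  [ffun _ => [ffun al : mon p 1 => if (al ord0 : nat) == 1%N then 1 else 0]].
Definition W1_1 (D : Wn F p 1) : Prop :=
  forall al : mon p 1, (al ord0 <= 1)%N -> D ord0 al = 0.

Definition embA n (f : Alg F p 1) : Alg F p n :=
  [ffun al : mon p n => \sum_(be : mon p 1)
     (if [forall k, (al k : nat) == (if (k : nat) == 0%N then (be ord0 : nat) else 0%N)]
      then f be else 0)].

(* Theta_S (f d_1) = f d_1 - f' x_2 d_2 ; on the basis:
   x_1^i d_1 |-> x_1^i d_1 - i x_1^(i-1) x_2 d_2 *)
Definition ThetaS n (D : Wn F p 1) : Wn F p n :=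
  [ffun j : 'I_n => if (j : nat) == 0%N then embA n (D ord0)
             else if (j : nat) == 1%N then
               - mulA (monoA (fun k : 'I_n => nat_of_bool ((k : nat) == 1%N)))
                      (embA n (derA ord0 (D ord0)))
             else 0].

Definition actS n (x : Wn F p 1) (D : Wn F p n) : Wn F p n := brW (ThetaS n x) D.

Section Modules.
Variables (V : lmodType F) (act : Wn F p 1 -> V -> V).

Definition subspace (U : V -> Prop) : Prop :=
  U 0 /\ forall (a : F) u v, U u -> U v -> U (a *: u + v).

Definition submod (U : V -> Prop) : Prop :=
  subspace U /\ forall D u, U u -> U (act D u).

Definition module_on (U : V -> Prop) : Prop :=
  (forall D (a : F) u v, U u -> U v -> act D (a *: u + v) = a *: act D u + act D v) /\
  (forall D E (a : F) v, U v -> act (a *: D + E) v = a *: act D v + act E v) /\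
  (forall D E v, U v -> act (brW D E) v = act D (act E v) - act E (act D v)).

Definition restricted_on (U : V -> Prop) : Prop :=
  forall D u, U u -> act (pmapW D) u = iter p (act D) u.

(* v spans a copy of F_lambda under W(1)_0 *)
Definition hw (lam : nat) (v : V) : Prop :=
  (forall D, W1_1 D -> act D v = 0) /\ act xdW1 v = lam%:R *: v.

Definition simple_on (U : V -> Prop) : Prop :=
  submod U /\ (exists u, U u /\ u <> 0) /\
  forall U' : V -> Prop, submod U' -> (forall u, U' u -> U u) ->
    (forall u, U' u -> u = 0) \/ (forall u, U u -> U' u).
End Modules.

Definition hom_on (V N : lmodType F) (act : Wn F p 1 -> V -> V)
    (actN : Wn F p 1 -> N -> N) (U : V -> Prop) (f : V -> N) : Prop :=
  (forall (a : F) u u', U u -> U u' -> f (a *: u + u') = a *: f u + f u') /\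
  (forall D u, U u -> f (act D u) = actN D (f u)).

(* U (with the action act) is isomorphic to the restricted baby Verma module
   V(lam) = u(W(1)) (x)_{u(W(1)_0)} F_lam : it is a restricted module with a
   vector v of type F_lam having the universal property of the induced module *)
Definition verma_sub (lam : nat) (V : lmodType F) (act : Wn F p 1 -> V -> V)
    (U : V -> Prop) : Prop :=
  submod act U /\ module_on act U /\ restricted_on act U /\
  exists v, U v /\ hw act lam v /\
  forall (N : lmodType F) (actN : Wn F p 1 -> N -> N) (w : N),
    module_on actN (fun _ => True) -> restricted_on actN (fun _ => True) ->
    hw actN lam w ->
    (exists f : V -> N, hom_on act actN U f /\ f v = w) /\
    (forall f g : V -> N, hom_on act actN U f -> hom_on act actN U g ->
        f v = w -> g v = w -> forall u, U u -> f u = g u).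

(* U is isomorphic to L(lam): a simple (restricted) module which is a
   quotient (homomorphic image) of V(lam) *)
Definition simpleL_sub (lam : nat) (V : lmodType F) (act : Wn F p 1 -> V -> V)
    (U : V -> Prop) : Prop :=
  module_on act U /\ restricted_on act U /\ simple_on act U /\
  exists (M : lmodType F) (actM : Wn F p 1 -> M -> M),
    verma_sub lam actM (fun _ => True) /\
    exists g : M -> V, hom_on actM act (fun _ => True) g /\
      forall x, U x <-> exists y, x = g y.

End Witt.

(* Main.v *)
From Stdlib Require Import Classical_Prop.
From HB Require Import structures.
From mathcomp Require Import all_boot all_order all_algebra.
From mathcomp Require Import ring zify.
Require Import Defs.
Set Implicit Arguments. Unset Strict Implicit. Unset Printing Implicit Defensive.
Import Order.TTheory GRing.Theory.
Local Open Scope ring_scope.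

(** As a W(1)-module S(n) splits along the degrees in x_2, ..., x_n, since W(1) only moves
    the x_1-degree.  A field g(x_1) x^e d_j with j > 1 transforms like the density g (dx)^s
    for some s in the prime field, and g(x_1) x^d d_1 does so up to a d_2-term which is
    absorbed when the field is completed to a divergence-free one; the completion uses the
    first x_q with q > 1 whose exponent in x^d is not p-1.  So S(n) is a direct sum of
    density modules T_s, except for the n-1 corner degrees, where membership in
    [S~(n), S~(n)] cuts T_1 down to the exact forms.  The top power x^(p-1) generates T_s
    freely over d/dx, hence T_s = V(s-1); T_s is simple for s <> 0, 1, and the exact forms in
    T_1 are the image of T_0 = V(p-1) under d/dx, that is L(p-1). *)

(** In each degree x^d, zero divergence is one equation. Unless all exponents of x^d are p-1, it is
    solved for the coefficient of one field x^(d+eps_q) d_q, and the pair (q, d+eps_q), no longer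
    free, is reused to index the d_1-field of degree d. So all pairs (j, e), with j among x_2, ...,
    x_n and x^e a monomial in these variables, index the summands.

    Taking the first q makes the weights come out: the stray term f'' g x_2 x^d d_2 is a multiple of
    the correction when q is x_2, and otherwise x_2 has exponent p-1 in x^d and the term is 0.

    Reusing pairs explains the +1 and -1 in the multiplicities. Without it every weight would occur
    (n-1)p^(n-2) times. For j = x_2 it moves, on balance, p^(n-2) pairs from weight 0 to weight 1;
    for the other j it moves p^(n-2) - 1 pairs from weight 1 to weight 0, one less because the
    degree with all exponents p-1 has no q.

    V(lam) is recognised by its universal property among restricted modules, so T_s must be shown to
    be restricted, which needs the p-th power of the action. *)

Definition incr n (i : 'I_n) (e : 'I_n -> nat) : 'I_n -> nat :=
  fun k => (e k + (k == i))%N.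

Definition decr n (i : 'I_n) (e : 'I_n -> nat) : 'I_n -> nat :=
  fun k => (e k - (k == i))%N.

(** * The algebra A(n): monomials, product, partial derivatives *)

Section TruncatedPolynomials.
Variables (F : fieldType) (p n : nat).
Implicit Types (f g h : Alg F p n) (e : 'I_n -> nat) (al be ga : mon p n).

Lemma eq_monoA e e' : e =1 e' -> monoA F p e = monoA F p e'.
Proof.
move=> ee; apply/ffunP => al; rewrite !ffunE.
by under eq_forallb => k do rewrite ee.
Qed.

Lemma monoA_mon al be : monoA F p (fun k => al k : nat) be = (be == al)%:R.
Proof.
rewrite ffunE; case: eqP => [->|ne].
  by case: forallP => // [[]].
case: forallP => // H; case: ne; apply/ffunP => k; apply/val_inj/eqP/H.
Qed.

Lemma monoA_oor e (i : 'I_n) : (p <= e i)%N -> monoA F p e = 0.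
Proof.
move=> le; apply/ffunP => al; rewrite !ffunE; case: forallP => // /(_ i) /eqP E.
by have := ltn_ord (al i); rewrite E ltnNge le.
Qed.

Lemma monoAP e : (exists al : mon p n, forall k, e k = al k :> nat)
  \/ (exists i, p <= e i)%N.
Proof.
case: (boolP [forall i, e i < p]%N) => [/forallP lt|].
  by left; exists [ffun k => Ordinal (lt k)] => k; rewrite ffunE.
by rewrite negb_forall => /existsP[i]; rewrite -leqNgt => le; right; exists i.
Qed.

Lemma Alg_sum_mono f : f = \sum_al f al *: monoA F p (fun k => al k : nat).
Proof.
apply/ffunP => be; rewrite sum_ffunE (bigD1 be) //= big1 => [|al ne].
  by rewrite ffunE monoA_mon eqxx addr0; exact/esym/mulr1.
by rewrite ffunE monoA_mon eq_sym (negPf ne); exact: mulr0.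
Qed.

Lemma mulA_is_linear f : linear (mulA f).
Proof.
move=> c g h; apply/ffunP => ga; rewrite !ffunE /= scaler_sumr -big_split /=.
apply: eq_bigr => al _; rewrite scaler_sumr -big_split /=.
apply: eq_bigr => be _; rewrite !ffunE; case: ifP => _; last by rewrite scaler0 addr0.
by rewrite mulrDr; congr (_ + _); exact: mulrCA.
Qed.
HB.instance Definition _ f :=
  GRing.isLinear.Build F (Alg F p n) (Alg F p n) _ (mulA f) (mulA_is_linear f).

Lemma mulAC f g : mulA f g = mulA g f.
Proof.
apply/ffunP => ga; rewrite !ffunE exchange_big; apply: eq_bigr => be _.
apply: eq_bigr => al _; rewrite [g be * _]mulrC.
by under eq_forallb => k do rewrite addnC.
Qed.

Lemma derA_is_linear i : linear (@derA F p n i).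
Proof.
move=> c f g; apply/ffunP => ga; rewrite !ffunE /= scaler_sumr -big_split /=.
apply: eq_bigr => al _; rewrite !ffunE; case: ifP => _; last by rewrite scaler0 addr0.
by rewrite mulrDr; congr (_ + _); exact: mulrCA.
Qed.
HB.instance Definition _ i :=
  GRing.isLinear.Build F (Alg F p n) (Alg F p n) _ (@derA F p n i) (derA_is_linear i).

Lemma derAZ i c f : derA i (c *: f) = c *: derA i f.
Proof. exact: linearZ. Qed.

Lemma mulAZr c f g : mulA f (c *: g) = c *: mulA f g.
Proof. exact: linearZ. Qed.

Lemma mulADl f g h : mulA (f + g) h = mulA f h + mulA g h.
Proof. by rewrite mulAC linearD /= ![mulA h _]mulAC. Qed.

Lemma mulAZl c f h : mulA (c *: f) h = c *: mulA f h.
Proof. by rewrite mulAC linearZ /= mulAC. Qed.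

Lemma mulA0l h : mulA 0 h = 0.
Proof. by rewrite mulAC linear0. Qed.

Lemma mulA_suml (I : Type) (r : seq I) (P : pred I) (G : I -> Alg F p n) h :
  mulA (\sum_(i <- r | P i) G i) h = \sum_(i <- r | P i) mulA (G i) h.
Proof. by rewrite mulAC linear_sum /=; apply: eq_bigr => i _; exact: mulAC. Qed.

Lemma mulA_mono e e' :
  mulA (monoA F p e) (monoA F p e') = monoA F p (fun k => e k + e' k)%N.
Proof.
have oor e1 e2 i : (p <= e1 i)%N ->
    mulA (monoA F p e1) (monoA F p e2) = monoA F p (fun k => e1 k + e2 k)%N.
  move=> le; rewrite (monoA_oor le) mulA0l (@monoA_oor _ i) //.
  exact: leq_trans (leq_addr _ _).
have [[al Ea]|[i le]] := monoAP e; last exact: oor le.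
have [[be Eb]|[i le]] := monoAP e'; last first.
  by rewrite mulAC (oor _ _ _ le); apply: eq_monoA => k; rewrite addnC.
rewrite (eq_monoA Ea) (eq_monoA Eb).
rewrite [RHS](@eq_monoA _ (fun k => al k + be k)%N) => [|k]; last by rewrite Ea Eb.
apply/ffunP => ga; rewrite [LHS]ffunE (bigD1 al) //= [X in _ + X]big1 => [|al' ne]; last first.
  by apply: big1 => be' _; rewrite monoA_mon (negPf ne) mul0r if_same.
rewrite addr0 (bigD1 be) //= [X in _ + X]big1 => [|be' ne]; last first.
  by rewrite [X in _ * X]monoA_mon (negPf ne) mulr0 if_same.
rewrite !monoA_mon !eqxx mulr1 addr0 ffunE.
by under eq_forallb => k do rewrite eq_sym.
Qed.

Lemma mulA_one f : mulA (monoA F p (fun=> 0%N)) f = f.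
Proof.
rewrite {1}(Alg_sum_mono f) linear_sum [RHS]Alg_sum_mono; apply: eq_bigr => al _.
by rewrite linearZ /= mulA_mono; congr (_ *: _); exact: eq_monoA.
Qed.

Lemma derA_top i f ga : (ga i).+1 = p -> derA i f ga = 0.
Proof.
move=> E; rewrite ffunE big1 // => al _; rewrite E.
by rewrite (ltn_eqF (ltn_ord (al i))).
Qed.

Lemma derAE i f ga al : (al i : nat) = (ga i).+1 ->
  (forall k, k != i -> al k = ga k) -> derA i f ga = (ga i).+1%:R * f al.
Proof.
move=> Ei Ek; rewrite ffunE (bigD1 al) //= Ei eqxx /=.
case: forallP => [_|[]]; last by move=> k; apply/implyP => /Ek->.
rewrite big1 ?addr0 // => be ne; case: ifP => // /andP[/eqP E1 /forallP E2].
case/eqP: ne; apply/ffunP => k; have := E2 k; case: (eqVneq k i) => [-> _|ki /eqP->].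
  by apply/val_inj; rewrite /= E1 Ei.
by rewrite Ek.
Qed.

Hypothesis charp : p \in [pchar F].

(** Here characteristic p enters: for [e i = p] the left side is 0 by truncation and the right side
    because p = 0 in [F]. For [e i = 0] the truncated subtraction in [decr] is masked by the
    coefficient. So exponents may be arbitrary naturals. *)
Lemma derA_mono i e : derA i (monoA F p e) = (e i)%:R *: monoA F p (decr i e).
Proof.
have [[al Ea]|[k le]] := monoAP e; last first.
  rewrite (monoA_oor le) linear0; case: (eqVneq k i) => [ki|ne]; last first.
    by rewrite (@monoA_oor _ k) ?scaler0 // /decr (negPf ne) subn0.
  move: le; rewrite leq_eqVlt ki => /orP[/eqP<-|lt]; first by rewrite pcharf0 // scale0r.
  by rewrite (@monoA_oor _ i) ?scaler0 // /decr eqxx /=; case: (e i) lt => // a; rewrite subn1.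
rewrite (eq_monoA Ea); apply/ffunP => ga; rewrite !ffunE /= (bigD1 al) //= big1 => [|be ne]; last first.
  by rewrite monoA_mon (negPf ne) mulr0 if_same.
rewrite monoA_mon eqxx mulr1 addr0 Ea.
case: (posnP (al i)) => [-> /=|pos]; first by rewrite scale0r.
have -> : [forall k, nat_of_ord (ga k) == decr i e k] =
    ((al i == (ga i).+1 :> nat) && [forall k, (k != i) ==> (al k == ga k)]).
  apply/forallP/andP => [H|[/eqP E1 /forallP H] k].
    split; first by have /eqP-> := H i; rewrite /decr eqxx Ea subn1 prednK.
    apply/forallP => k; apply/implyP => ki; have := H k.
    by rewrite /decr (negPf ki) subn0 Ea eq_sym.
  rewrite /decr Ea; case: (eqVneq k i) => [->|ki]; first by rewrite E1 subn1.
  by have := H k; rewrite ki subn0 => /eqP->.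
by case: ifP => _; [exact/esym/mulr1|rewrite scaler0].
Qed.

Lemma derA_mul i f g : derA i (mulA f g) = mulA (derA i f) g + mulA f (derA i g).
Proof.
rewrite (Alg_sum_mono f) !mulA_suml !linear_sum !mulA_suml -big_split /=; apply: eq_bigr => al _.
rewrite derAZ !mulAZl derAZ -scalerDr; congr (_ *: _).
rewrite (Alg_sum_mono g) !linear_sum -big_split /=; apply: eq_bigr => be _.
rewrite derAZ !mulAZr derAZ -scalerDr; congr (_ *: _).
rewrite mulA_mono !derA_mono mulAZr mulAZl !mulA_mono natrD scalerDl.
(* Truncated subtraction commutes with adding [b] except when [a i = 0], where the coefficient
   vanishes. *)
have key (a b : mon p n) : (a i)%:R *: monoA F p (decr i (fun k : 'I_n => (a k + b k)%N))
  = (a i)%:R *: monoA F p (fun k : 'I_n => (decr i (fun k : 'I_n => a k) k + b k)%N).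
  case: (posnP (a i)) => [->|pos]; first by rewrite !scale0r.
  congr (_ *: _); apply: eq_monoA => k; rewrite /decr.
  by case: eqP => [->|_]; rewrite ?subn0 // addnBAC.
rewrite -key; congr (_ + _); under eq_monoA => k do rewrite /decr addnC.
by rewrite -/(decr _ _) key; congr (_ *: _); apply: eq_monoA => k; rewrite addnC.
Qed.

Lemma derA_comm i k f : derA i (derA k f) = derA k (derA i f).
Proof.
rewrite (Alg_sum_mono f) !linear_sum /=; apply: eq_bigr => al _.
rewrite !derAZ !derA_mono !derAZ !derA_mono !scalerA.
case: (eqVneq i k) => [->//|ne]; congr (_ *: _); last first.
  by apply: eq_monoA => l; rewrite /decr subnAC.
by rewrite -!mulrA; congr (_ * _); rewrite /decr [k == i]eq_sym (negPf ne) !subn0 mulrC.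
Qed.

End TruncatedPolynomials.

(** * Fields f d_i, curls, and membership in S(n) *)

Definition dW (F : fieldType) (p n : nat) (i : 'I_n) (f : Alg F p n) : Wn F p n :=
  [ffun j => if j == i then f else 0].

(* The generators written D_ij(f) in the literature. *)
Definition curlW (F : fieldType) (p n : nat) (i j : 'I_n) (f : Alg F p n) : Wn F p n :=
  dW i (derA j f) - dW j (derA i f).

Section Derivations.
Variables (F : fieldType) (p n : nat).
Implicit Types (f g h : Alg F p n) (D E : Wn F p n).

Lemma dW_is_linear i : linear (@dW F p n i).
Proof.
move=> c f g; apply/ffunP => j; rewrite !ffunE.
by case: ifP => _ //; rewrite scaler0 addr0.
Qed.
HB.instance Definition _ i :=
  GRing.isLinear.Build F (Alg F p n) (Wn F p n) _ (@dW F p n i) (dW_is_linear i).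

Lemma dWZ i c f : dW i (c *: f) = c *: dW i f.
Proof. exact: linearZ. Qed.

Lemma applyD_linear D : linear (applyD D).
Proof.
move=> c f g; rewrite /applyD scaler_sumr -big_split; apply: eq_bigr => i _ /=.
by rewrite linearP /= linearP.
Qed.

Lemma applyD_linearl f c D E : applyD (c *: D + E) f = c *: applyD D f + applyD E f.
Proof.
rewrite /applyD scaler_sumr -big_split; apply: eq_bigr => i _ /=.
by rewrite !ffunE mulADl mulAZl.
Qed.

Lemma brW_linear D : linear (brW D).
Proof.
move=> c E E'; apply/ffunP => j; rewrite !ffunE applyD_linear applyD_linearl.
by rewrite scalerBr opprD addrACA.
Qed.
HB.instance Definition _ D :=
  GRing.isLinear.Build F (Wn F p n) (Wn F p n) _ (brW D) (brW_linear D).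

Lemma brWN D E : brW D E = - brW E D.
Proof. by apply/ffunP => j; rewrite !ffunE opprB. Qed.

Lemma brWDl D D' E : brW (D + D') E = brW D E + brW D' E.
Proof. by rewrite brWN linearD /= opprD -!brWN. Qed.

Lemma brWNl D E : brW (- D) E = - brW D E.
Proof. by rewrite brWN linearN /= opprK brWN. Qed.

Lemma divW_is_linear : linear (@divW F p n).
Proof.
move=> c D E; rewrite /divW scaler_sumr -big_split; apply: eq_bigr => i _ /=.
by rewrite !ffunE linearP.
Qed.
HB.instance Definition _ :=
  GRing.isLinear.Build F (Wn F p n) (Alg F p n) _ (@divW F p n) divW_is_linear.

Lemma divW_dW i f : divW (dW i f) = derA i f.
Proof.
rewrite /divW (bigD1 i) //= ffunE eqxx big1 ?addr0 // => k ne.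
by rewrite ffunE (negPf ne) linear0.
Qed.

Lemma applyD_dW i f g : applyD (dW i f) g = mulA f (derA i g).
Proof.
rewrite /applyD (bigD1 i) //= ffunE eqxx big1 ?addr0 // => k ne.
by rewrite ffunE (negPf ne) mulA0l.
Qed.

Lemma brW_dW i j f g :
  brW (dW i f) (dW j g) = dW j (mulA f (derA i g)) - dW i (mulA g (derA j f)).
Proof.
apply/ffunP => k; rewrite !ffunE !applyD_dW.
by do 2!case: ifP => _; rewrite ?linear0 ?mulA0r.
Qed.

Lemma Sn_brW D E : Stilde D -> Stilde E -> Sn (brW D E).
Proof.
move=> SD SE; exists 1%N, (fun=> 1), (fun=> D), (fun=> E); split=> //.
by rewrite big_ord1 scale1r.
Qed.

Lemma SnP c D E : Sn D -> Sn E -> Sn (c *: D + E).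
Proof.
move=> [m1 [c1 [a1 [b1 [H1 ->]]]]] [m2 [c2 [a2 [b2 [H2 ->]]]]].
pose glue (T : Type) (x : 'I_m1 -> T) (y : 'I_m2 -> T) (k : 'I_(m1 + m2)) :=
  match split k with inl i => x i | inr i => y i end.
exists (m1 + m2)%N, (glue _ (fun k => c * c1 k) c2), (glue _ a1 a2), (glue _ b1 b2).
split=> [k|]; first by rewrite /glue; case: split.
rewrite big_split_ord /= scaler_sumr; congr (_ + _); apply: eq_bigr => k _;
  rewrite /glue.
  by rewrite (unsplitK (inl k)) scalerA.
by rewrite (unsplitK (inr k)).
Qed.

Lemma Sn0 : Sn (0 : Wn F p n).
Proof. by exists 0%N, (fun=> 0), (fun=> 0), (fun=> 0); split=> [[]//|]; rewrite big_ord0. Qed.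

Lemma SnZ c D : Sn D -> Sn (c *: D).
Proof. by move=> SD; rewrite -[c *: D]addr0; apply: SnP => //; exact: Sn0. Qed.

Lemma Sn_sum (I : Type) (r : seq I) (P : pred I) (G : I -> Wn F p n) :
  (forall i, P i -> Sn (G i)) -> Sn (\sum_(i <- r | P i) G i).
Proof.
move=> SG; apply: (big_ind (fun D => Sn D)) => //; first exact: Sn0.
by move=> D E SD SE; rewrite -[D]scale1r; exact: SnP.
Qed.

Lemma curlW_is_linear i j : linear (@curlW F p n i j).
Proof.
by move=> c f g; rewrite /curlW !derA_is_linear !dW_is_linear scalerBr opprD addrACA.
Qed.
HB.instance Definition _ i j :=
  GRing.isLinear.Build F (Alg F p n) (Wn F p n) _ (@curlW F p n i j) (curlW_is_linear i j).

Hypothesis charp : p \in [pchar F].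

Lemma brW_dW1 k i f : brW (dW k (monoA F p (fun=> 0%N))) (dW i f) = dW i (derA k f).
Proof.
by rewrite brW_dW mulA_one derA_mono // scale0r linear0 linear0 subr0.
Qed.

Lemma curlW_Stilde i j f : Stilde (curlW i j f).
Proof. by rewrite /Stilde linearB /= !divW_dW derA_comm // subrr. Qed.

Lemma dW1_Stilde k : Stilde (dW k (monoA F p (fun=> 0%N)) : Wn F p n).
Proof. by rewrite /Stilde divW_dW derA_mono // scale0r. Qed.

Lemma natf_neq0 k : (0 < k < p)%N -> k%:R != 0 :> F.
Proof.
move=> /andP[k0 kp]; rewrite -(dvdn_pcharf charp); apply/negP => /(dvdn_leq k0).
by rewrite leqNgt kp.
Qed.

(** A monomial with some exponent below p-1 is, up to a scalar, a derivative in x_k, and bracketing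
    with the constant field d_k carries that derivative out of the curl. Only the monomial with all
    exponents p-1 needs a different bracket. *)
Lemma curlW_Sn i j f : i != j -> Sn (curlW i j f).
Proof.
move=> ij; rewrite (Alg_sum_mono f) linear_sum; apply: Sn_sum => al _.
rewrite linearZ; apply: SnZ => /=.
case: (boolP [exists k, (al k).+1 < p]%N) => [/existsP[k lt]|].
  have -> : monoA F p (fun k => al k : nat) = ((al k).+1%:R)^-1 *:
      derA k (monoA F p (incr k (fun k => al k : nat))).
    rewrite derA_mono // /incr eqxx addn1 scalerA mulVf ?natf_neq0 // scale1r.
    by apply: eq_monoA => l; rewrite /decr addnK.
  rewrite linearZ; apply: SnZ => /=.
  set g := monoA _ _ _.
  suff -> : curlW i j (derA k g) = brW (dW k (monoA F p (fun=> 0%N))) (curlW i j g).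
    apply: Sn_brW; [exact: dW1_Stilde | exact: curlW_Stilde].
  by rewrite /curlW linearB /= !brW_dW1 ![derA k (derA _ _)]derA_comm.
rewrite negb_exists => /forallP top.
have {}top k : al k = p.-1 :> nat.
  by have := top k; have := ltn_ord (al k); lia.
(* x^e1 omits x_i and x^e2 is a power of x_i, so x^e1 d_i and x^e2 d_j are divergence-free, while
   x^e1 x^e2 is the top monomial. *)
pose e1 (k : 'I_n) := if k == i then 0%N else p.-1.
pose e2 (k : 'I_n) := if k == i then p.-1 else 0%N.
have -> : curlW i j (monoA F p (fun k => al k : nat)) =
    -1 *: brW (dW i (monoA F p e1)) (dW j (monoA F p e2)).
  rewrite brW_dW scaleN1r opprB /curlW !derA_mono // !mulAZr !mulA_mono.
  have ji : (j == i) = false by rewrite eq_sym (negPf ij).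
  have -> : e2 i = p.-1 by rewrite /e2 eqxx.
  have -> : e1 j = p.-1 by rewrite /e1 ji.
  rewrite !top; congr (dW _ (_ *: _) - dW _ (_ *: _)); apply: eq_monoA => k;
    rewrite /decr top /e1 /e2.
    by case: (eqVneq k i) => [->|ne]; rewrite ?(negPf ij) //= ?subn0 ?addn0 ?add0n.
  by case: (eqVneq k i) => [_|ne]; rewrite ?subn0 ?addn0 ?add0n.
apply/SnZ/Sn_brW; rewrite /Stilde divW_dW derA_mono //.
  by rewrite /e1 eqxx scale0r.
by rewrite /e2 eq_sym (negPf ij) scale0r.
Qed.

(** When [divW D = 0], applying [D] to h gives the divergence of hD. So a bracket is the divergence
    of an antisymmetric tensor, and antisymmetry yields both [Sn_divW] and [Sn_top]. *)
Lemma brW_curl D E j : Stilde D -> Stilde E ->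
  brW D E j = \sum_i derA i (mulA (D i) (E j) - mulA (E i) (D j)).
Proof.
have key D1 E1 : Stilde D1 ->
    applyD D1 (E1 j) = \sum_i derA i (mulA (D1 i) (E1 j)).
  move=> dD; under eq_bigr do rewrite derA_mul //.
  rewrite big_split /= -mulA_suml.
  by move: dD; rewrite /Stilde /divW => ->; rewrite mulA0l add0r.
move=> dD dE; rewrite ffunE !key // -sumrB; apply: eq_bigr => i _.
by rewrite linearB.
Qed.

Lemma Sn_divW D : Sn D -> divW D = 0.
Proof.
move=> [m [c [a [b [ab ->]]]]]; rewrite linear_sum big1 // => k _; rewrite linearZ /=.
have [da db] := ab k; apply/eqP; rewrite scaler_eq0; apply/orP; right; apply/eqP.
rewrite /divW; under eq_bigr => j _ do rewrite brW_curl // linear_sum /=.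
under eq_bigr => j _ do under eq_bigr => i _ do rewrite !linearB /=.
under eq_bigr => j _ do rewrite big_split /=.
rewrite big_split /= [X in _ + X]exchange_big /= -big_split big1 // => i _ /=.
rewrite -big_split big1 // => j _ /=.
by rewrite [in X in _ - X]mulAC derA_comm // subrr.
Qed.

(** The term i = j of [brW_curl] vanishes by antisymmetry, and a derivative in x_i contains no
    x_i^(p-1). This is what separates S(n) from the algebra of all divergence-free fields. *)
Lemma Sn_top D j (ga : mon p n) :
  Sn D -> (forall k, k != j -> (ga k).+1 = p) -> D j ga = 0.
Proof.
move=> [m [c [a [b [ab ->]]]]] top; rewrite !sum_ffunE big1 // => k _.
have -> (c0 : F) (B : Wn F p n) : (c0 *: B) j ga = c0 *: B j ga by rewrite !ffunE.
have [da db] := ab k; rewrite brW_curl // sum_ffunE big1 ?scaler0 // => i _.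
case: (eqVneq i j) => [->|ne]; last by rewrite derA_top // top.
by rewrite mulAC subrr linear0 ffunE.
Qed.

End Derivations.

(** * Slices of A(n) along the monomials in x_2, ..., x_n *)

Definition mexp m (a : nat) (e : 'I_m -> nat) : 'I_m.+1 -> nat :=
  fun k => oapp e a (unlift ord0 k).

Definition mcons p m (a : 'I_p) (e : mon p m) : mon p m.+1 :=
  [ffun k => oapp e a (unlift ord0 k)].

(* [polyA e g] is g(x_1) x_2^(e 0) x_3^(e 1) ..., which is 0 when some [e k] exceeds p-1. *)
Definition polyA (F : fieldType) (p m : nat) (e : 'I_m -> nat) (g : {poly F}) : Alg F p m.+1 :=
  [ffun al : mon p m.+1 =>
     if [forall k, (al (lift ord0 k) : nat) == e k] then g`_(al ord0) else 0].
Arguments polyA {F p m} e g.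

Section PolynomialSlices.
Variables (F : fieldType) (p m : nat).
Implicit Types (f g h : {poly F}) (e : 'I_m -> nat) (al be : mon p m.+1).
Local Notation P := (@polyA F p m).

Lemma polyA_is_linear e : linear (P e).
Proof.
move=> c f g; apply/ffunP => al; rewrite !ffunE.
by case: ifP => _; rewrite ?coefD ?coefZ ?scaler0 ?addr0.
Qed.
HB.instance Definition _ e :=
  GRing.isLinear.Build F {poly F} (Alg F p m.+1) _ (P e) (polyA_is_linear e).

Lemma polyAZ e c g : P e (c *: g) = c *: P e g.
Proof. exact: linearZ. Qed.

Lemma eq_polyA e e' g : e =1 e' -> P e g = P e' g.
Proof.
move=> ee; apply/ffunP => al; rewrite !ffunE.
by under eq_forallb => k do rewrite ee.
Qed.

Lemma polyA_oor e j g : (p <= e j)%N -> P e g = 0.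
Proof.
move=> le; apply/ffunP => al; rewrite !ffunE; case: forallP => // /(_ j) /eqP E.
by have := ltn_ord (al (lift ord0 j)); rewrite E ltnNge le.
Qed.

Lemma forall_ord0 (Q : pred 'I_m.+1) :
  [forall k, Q k] = Q ord0 && [forall k, Q (lift ord0 k)].
Proof.
apply/forallP/andP => [H|[H0 /forallP H] k]; first by split=> //; apply/forallP.
by case: (unliftP ord0 k) => [j|] ->.
Qed.

Lemma polyA_Xn e a : P e 'X^a = monoA F p (mexp a e).
Proof.
apply/ffunP => al; rewrite !ffunE forall_ord0 coefXn /mexp unlift_none /=.
under [X in _ = if _ && X then _ else _]eq_forallb => k do rewrite liftK /=.
by rewrite andbC; case: ifP => _ //=; case: eqP.
Qed.

Lemma polyA_sum e g : P e g = \sum_(i < size g) g`_i *: monoA F p (mexp i e).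
Proof.
rewrite -{1}[g]coefK poly_def linear_sum; apply: eq_bigr => i _ /=.
by rewrite polyAZ polyA_Xn.
Qed.

(** Truncation in x_1 is done by the index type of the coefficients, so polynomials of any degree
    may be multiplied and calculations in x_1 can be left to [ring]. *)
Lemma polyA_mul e e' f g : mulA (P e f) (P e' g) = P (fun k => e k + e' k)%N (f * g).
Proof.
rewrite -[f]coefK poly_def mulr_suml !linear_sum mulA_suml.
apply: eq_bigr => i _ /=; rewrite -scalerAl !polyAZ mulAZl; congr (_ *: _).
rewrite -[g]coefK poly_def mulr_sumr !linear_sum.
apply: eq_bigr => j _ /=; rewrite -scalerAr !polyAZ mulAZr; congr (_ *: _).
rewrite -exprD !polyA_Xn mulA_mono; apply: eq_monoA => k.
by rewrite /mexp; case: unliftP.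
Qed.

Hypothesis charp : p \in [pchar F].

Lemma polyA_der0 e g : derA ord0 (P e g) = P e g^`().
Proof.
rewrite -[g]coefK poly_def !linear_sum; apply: eq_bigr => i _ /=.
rewrite polyAZ derAZ derivZ polyAZ; congr (_ *: _).
rewrite derivXn -scaler_nat polyAZ !polyA_Xn derA_mono //.
rewrite {1}/mexp unlift_none /=; congr (_ *: _); apply: eq_monoA => k.
rewrite /decr /mexp; case: unliftP => [j|] ->; last by rewrite eqxx subn1.
by rewrite eq_sym (negPf (neq_lift _ _)) subn0.
Qed.

Lemma polyA_derS e j g : derA (lift ord0 j) (P e g) = (e j)%:R *: P (decr j e) g.
Proof.
rewrite !polyA_sum linear_sum scaler_sumr; apply: eq_bigr => i _ /=.
rewrite derAZ derA_mono // !scalerA [_ * g`_i]mulrC /mexp liftK /=; congr (_ *: _).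
apply: eq_monoA => k; rewrite /decr; case: unliftP => [l|] -> /=.
  by rewrite (inj_eq lift_inj).
by rewrite subn0.
Qed.

Lemma mcons0 a (e : mon p m) : mcons a e ord0 = a.
Proof. by rewrite ffunE unlift_none. Qed.

Lemma mconsS a (e : mon p m) k : mcons a e (lift ord0 k) = e k.
Proof. by rewrite ffunE liftK. Qed.

Lemma monS_ind (Q : mon p m.+1 -> Prop) : (forall a (e : mon p m), Q (mcons a e)) -> forall al, Q al.
Proof.
move=> H al; have -> : al = mcons (al ord0) [ffun k => al (lift ord0 k)] => //.
by apply/ffunP => k; rewrite !ffunE; case: (unliftP ord0 k) => [j|] -> //=; rewrite ffunE.
Qed.

Lemma polyA_mcons e g a (d : mon p m) :
  P e g (mcons a d) = if [forall k, (d k : nat) == e k] then g`_a else 0.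
Proof.
rewrite ffunE mcons0; by under eq_forallb => k do rewrite mconsS.
Qed.

End PolynomialSlices.

(** * Density modules over W(1) and their p-th powers *)

Section DensityModules.
Variables (F : fieldType) (p : nat).
Hypothesis charp : p \in [pchar F].
Local Notation T := {ffun 'I_p -> F^o}.
Implicit Types (f g h phi : {poly F}) (D E : Wn F p 1) (v : T) (s : F).

(** [T] is F[x]/(x^p), stored by coefficients. Identities are proved in [{poly F}] and pushed down;
    [liftp] is only a linear section. *)
Definition truncp (g : {poly F}) : T := [ffun i : 'I_p => g`_i].
Definition liftp (v : T) : {poly F} := \sum_(i < p) (v i : F) *: 'X^i.

Lemma truncp_is_linear : linear truncp.
Proof. by move=> c f g; apply/ffunP => i; rewrite !ffunE coefD coefZ. Qed.
HB.instance Definition _ := GRing.isLinear.Build F {poly F} T _ truncp truncp_is_linear.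

Lemma liftp_is_linear : linear liftp.
Proof.
move=> c f g; rewrite /liftp scaler_sumr -big_split; apply: eq_bigr => i _ /=.
by rewrite !ffunE scalerA -scalerDl.
Qed.
HB.instance Definition _ := GRing.isLinear.Build F T {poly F} _ liftp liftp_is_linear.

Lemma coef_sumXn (c : 'I_p -> F) (a : 'I_p) : (\sum_(i < p) c i *: 'X^i)`_a = c a.
Proof.
rewrite coef_sum (bigD1 a) //= coefZ coefXn eqxx mulr1 big1 ?addr0 // => i ne.
by rewrite coefZ coefXn eq_sym (inj_eq val_inj) (negPf ne) mulr0.
Qed.

Lemma liftpK : cancel liftp truncp.
Proof. by move=> v; apply/ffunP => a; rewrite ffunE coef_sumXn. Qed.

Lemma truncp_coef g h : truncp g = truncp h -> forall i, (i < p)%N -> g`_i = h`_i.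
Proof. by move=> E i lt; have := congr1 (fun v : T => v (Ordinal lt)) E; rewrite !ffunE. Qed.

Lemma truncp_mulr f g h : truncp g = truncp h -> truncp (f * g) = truncp (f * h).
Proof.
move=> E; apply/ffunP => a; rewrite !ffunE !coefM; apply: eq_bigr => i _.
by rewrite (truncp_coef E) // (leq_ltn_trans _ (ltn_ord a)) // leq_subr.
Qed.

Lemma truncp_mul f f' g g' : truncp f = truncp f' -> truncp g = truncp g' ->
  truncp (f * g) = truncp (f' * g').
Proof.
move=> Ef Eg; rewrite (truncp_mulr f Eg) ![_ * g']mulrC; exact: truncp_mulr.
Qed.

(** The ideal (x^p) is stable under d/dx because the coefficient of x^(p-1) in g' is p times that of
    x^p in g. *)
Lemma truncp_deriv g h : truncp g = truncp h -> truncp g^`() = truncp h^`().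
Proof.
move=> E; apply/ffunP => a; rewrite !ffunE !coef_deriv.
case: (leqP p a.+1) => [le|lt]; last by rewrite (truncp_coef E).
have -> : a.+1 = p by apply/eqP; rewrite eqn_leq le andbT.
by rewrite !mulrn_pchar.
Qed.

Lemma eq_truncp_polyA m (e : 'I_m -> nat) g h :
  truncp g = truncp h -> polyA e g = polyA e h :> Alg F p m.+1.
Proof.
by move=> E; apply/ffunP => al; rewrite !ffunE (truncp_coef E).
Qed.

Lemma truncpXn k : (p <= k)%N -> truncp 'X^k = 0.
Proof.
move=> le; apply/ffunP => a; rewrite !ffunE coefXn; case: eqP => // E.
by have := ltn_ord a; rewrite E ltnNge le.
Qed.

Definition witt (g : {poly F}) : Wn F p 1 := dW ord0 (polyA (fun=> 0%N) g).
Definition witt_poly (D : Wn F p 1) : {poly F} :=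
  \sum_(i < p) (D ord0 [ffun=> i] : F) *: 'X^i.

Lemma witt_is_linear : linear witt.
Proof. by move=> c f g; rewrite /witt !linearP. Qed.
HB.instance Definition _ := GRing.isLinear.Build F {poly F} (Wn F p 1) _ witt witt_is_linear.

Lemma witt_poly_is_linear : linear witt_poly.
Proof.
move=> c D E; rewrite /witt_poly scaler_sumr -big_split; apply: eq_bigr => i _ /=.
by rewrite !ffunE scalerA -scalerDl.
Qed.
HB.instance Definition _ :=
  GRing.isLinear.Build F (Wn F p 1) {poly F} _ witt_poly witt_poly_is_linear.

Lemma witt_polyK : cancel witt_poly witt.
Proof.
move=> D; apply/ffunP => j; rewrite (ord1 j) ffunE eqxx; apply/ffunP => al.
rewrite ffunE; case: forallP => [_|[]]; last by case.
rewrite coef_sumXn; congr (D ord0 _); apply/ffunP => k; rewrite ffunE.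
by congr (al _); rewrite (ord1 k).
Qed.

Lemma wittK g : truncp (witt_poly (witt g)) = truncp g.
Proof.
apply/ffunP => a; rewrite !ffunE coef_sumXn ffunE eqxx ffunE.
by case: forallP => [_|[]]; [rewrite ffunE|case].
Qed.

Lemma applyD_witt f (e : 'I_0 -> nat) g :
  applyD (witt f) (polyA e g) = polyA (fun=> 0%N) (f * g^`()).
Proof.
by rewrite applyD_dW polyA_der0 // polyA_mul; apply: eq_polyA => -[].
Qed.

Lemma brW_witt f g : brW (witt f) (witt g) = witt (f * g^`() - g * f^`()).
Proof.
by rewrite brW_dW !polyA_der0 // !polyA_mul -linearB -linearB; congr dW; apply: eq_polyA => -[].
Qed.

Lemma pmapW_witt f :
  pmapW (witt f) = witt (iter p (fun g => f * g^`()) 'X).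
Proof.
apply/ffunP => j; rewrite (ord1 j) !ffunE eqxx.
have -> : varA F p (ord0 : 'I_1) = polyA (fun=> 0%N) 'X.
  rewrite -['X]expr1 polyA_Xn; apply: eq_monoA => k.
  by rewrite /mexp (ord1 k) unlift_none.
have gen k : iter k (applyD (witt f)) (polyA (fun=> 0%N) 'X) =
    polyA (fun=> 0%N) (iter k (fun g => f * g^`()) 'X).
  by elim: k => //= k ->; rewrite applyD_witt.
exact: gen.
Qed.

Lemma xdW1_witt : xdW1 F p = witt 'X.
Proof.
apply/ffunP => j; rewrite (ord1 j) !ffunE eqxx; apply/ffunP => al; rewrite !ffunE.
case: forallP => [_|[]]; last by case.
by rewrite coefX; case: eqP.
Qed.

Lemma W1_1_witt g : W1_1 (witt ('X^2 * g)).
Proof.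
move=> al le; rewrite ffunE eqxx ffunE; case: forallP => // _.
by rewrite coefXnM ltnS le.
Qed.

(* The action of phi d/dx on the densities g (dx)^s. *)
Definition rho s phi g : {poly F} := phi * g^`() + s *: (phi^`() * g).
Definition actT s (D : Wn F p 1) (v : T) : T := truncp (rho s (witt_poly D) (liftp v)).

Lemma rho_linear s phi : linear (rho s phi).
Proof.
move=> c f g; rewrite /rho linearP /= -!mul_polyC; ring.
Qed.
HB.instance Definition _ s phi :=
  GRing.isLinear.Build F {poly F} {poly F} _ (rho s phi) (rho_linear s phi).

Lemma rho_linearl s g c f h : rho s (c *: f + h) g = c *: rho s f g + rho s h g.
Proof. rewrite /rho linearP /= -!mul_polyC; ring. Qed.

Lemma rho_truncp s f f' g g' : truncp f = truncp f' -> truncp g = truncp g' ->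
  truncp (rho s f g) = truncp (rho s f' g').
Proof.
move=> Ef Eg; rewrite /rho !linearD /= !linearZ /=; congr (_ + _ *: _).
  by apply: truncp_mul => //; exact: truncp_deriv.
by apply: truncp_mul => //; exact: truncp_deriv.
Qed.

Lemma actTE s f g : actT s (witt f) (truncp g) = truncp (rho s f g).
Proof. by apply: rho_truncp; [exact: wittK | exact: liftpK]. Qed.

Lemma rho_lie s f h g :
  rho s (f * h^`() - h * f^`()) g = rho s f (rho s h g) - rho s h (rho s f g).
Proof.
rewrite /rho !(derivD, derivN, derivZ, derivM) -!mul_polyC; ring.
Qed.

Lemma actT_module s : module_on (actT s) (fun _ => True).
Proof.
split=> [D c u v _ _|]; first by rewrite /actT linearP rho_linear linearP.
split=> [D E c v _|D E v _].
  by rewrite /actT linearP rho_linearl linearP.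
rewrite -(witt_polyK D) -(witt_polyK E) -(liftpK v) brW_witt !actTE rho_lie.
exact: linearB.
Qed.

(* Powers of a twisted derivation: the middle binomial coefficients vanish. *)
Lemma iter_leibniz_pchar (a b c : {poly F} -> {poly F}) :
  {morph c : x y / x + y} -> (forall k x, c (x *+ k) = c x *+ k) ->
  (forall x y, c (x * y) = a x * y + x * b y) ->
  forall x y, iter p c (x * y) = iter p a x * y + x * iter p b y.
Proof.
move=> cD cM cL x y.
have main k : iter k c (x * y) =
    \sum_(i < k.+1) (iter (k - i) a x * iter i b y) *+ 'C(k, i).
  elim: k => [|k IH]; first by rewrite big_ord1 /= bin0 mulr1n.
  have c0 : c 0 = 0 by have := cM 0%N 0; rewrite !mulr0n.
  rewrite iterS IH (big_morph c cD c0).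
  under eq_bigr => i _ do rewrite cM cL mulrnDl.
  rewrite big_split /= [in RHS]big_ord_recl [X in X + _ = _]big_ord_recl /=.
  under [X in _ = _ + X]eq_bigr => i _ do rewrite /bump /= add1n binS mulrnDr subSS.
  rewrite big_split /= -!addrA subn0 !bin0; congr (_ + _).
  rewrite [in RHS]big_ord_recr /= bin_small // mulr0n addr0.
  congr (_ + _); apply: eq_bigr => i _.
  by rewrite /bump /= add1n -[a (iter _ _ _)]iterS subnSK.
have p0 := prime_gt0 (pcharf_prime charp).
have charP : p \in [pchar {poly F}] by rewrite (rmorph_pchar (@polyC F)).
rewrite main big_ord_recr /= subnn binn mulr1n; congr (_ + _).
rewrite (bigD1 (Ordinal p0)) //= subn0 bin0 mulr1n big1 ?addr0 // => i ne.
rewrite -mulr_natr bin_lt_pcharf_0 ?mulr0 // ltn_ord andbT lt0n.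
by apply: contra ne => /eqP i0; apply/eqP/val_inj.
Qed.

Lemma rho_leibniz s t phi g h :
  rho (s + t) phi (g * h) = rho s phi g * h + g * rho t phi h.
Proof. rewrite /rho derivM -!mul_polyC rmorphD /=; ring. Qed.

Lemma iter_rho_leibniz s t phi g h :
  iter p (rho (s + t) phi) (g * h) = iter p (rho s phi) g * h + g * iter p (rho t phi) h.
Proof.
apply: iter_leibniz_pchar; first exact: linearD.
- by move=> k x; exact: linearMn.
- exact: rho_leibniz.
Qed.

Lemma iter_rho0_const phi c : iter p (rho 0 phi) c%:P = 0.
Proof.
rewrite -(prednK (prime_gt0 (pcharf_prime charp))) iterSr /rho derivC scale0r mulr0 addr0.
by elim: p.-1 => //= k ->; rewrite deriv0 mulr0 add0r scale0r.
Qed.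

(** The p-th power of the derivation [rho 0 phi] is again a derivation, hence determined by its
    value at ['X]. *)
Lemma iter_rho0 phi g : iter p (rho 0 phi) g = iter p (rho 0 phi) 'X * g^`().
Proof.
have lin k : linear (iter k (rho 0 phi)).
  by elim: k => [//|k IH] c x y /=; rewrite IH rho_linear.
elim/poly_ind: g => [|g c IH]; first by rewrite deriv0 mulr0 -polyC0 iter_rho0_const.
have -> : g * 'X + c%:P = 1 *: (g * 'X) + c%:P by rewrite scale1r.
rewrite lin iter_rho0_const addr0 !scale1r derivD derivC addr0 derivM derivX.
have := iter_rho_leibniz 0 0 phi g 'X; rewrite addr0 => ->; rewrite IH; ring.
Qed.

(* d/dx intertwines functions (s = 0) and one-forms (s = 1), which settles s = 1;
   the other integral s follow from the Leibniz rule. *)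
Lemma iter_rho (k : nat) phi g :
  iter p (rho k%:R phi) g = rho k%:R (iter p (rho 0 phi) 'X) g.
Proof.
set psi := iter p (rho 0 phi) 'X.
have rho1_1 : iter p (rho 1 phi) 1 = psi^`().
  have gen j x : iter j (rho 1 phi) x^`() = (iter j (rho 0 phi) x)^`().
    elim: j => //= j ->; rewrite /rho !(derivD, derivM, derivZ) scale0r scale1r addr0.
    by rewrite addrC.
  by rewrite -(derivX F) gen.
elim: k g => [|k IH] g; first by rewrite iter_rho0 /rho scale0r addr0.
(* Weight k+1 is split as [g] of weight k times the one-form 1, on which the p-th power is known
   from [rho1_1]. *)
rewrite -natr1 -{1}[g]mulr1 iter_rho_leibniz IH rho1_1 /rho -!mul_polyC rmorphD /=; ring.
Qed.

(** The weight is a natural number since a restricted action forces s^p = s: x d/dx is its own p-th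
    power and acts on 1 by s. *)
Lemma actT_restricted (k : nat) : restricted_on (actT k%:R) (fun _ => True).
Proof.
move=> D v _; rewrite -(witt_polyK D) -(liftpK v) pmapW_witt actTE.
have -> j g : iter j (actT k%:R (witt (witt_poly D))) (truncp g) =
    truncp (iter j (rho k%:R (witt_poly D)) g).
  by elim: j => //= j ->; rewrite actTE.
rewrite iter_rho; congr (truncp (rho _ _ _)); apply: eq_iter => g.
by rewrite /rho scale0r addr0.
Qed.

End DensityModules.

(** * Linearity of an abstract W(1)-action *)

Section ModuleTheory.
Variables (F : fieldType) (p : nat) (N : lmodType F) (act : Wn F p 1 -> N -> N).
Hypothesis actM : module_on act (fun _ => True).

Lemma act_linear D : linear (act D).
Proof. by move=> c u v; have [H _] := actM; exact: H. Qed.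

Lemma act_Dr D u v : act D (u + v) = act D u + act D v.
Proof. by have := act_linear D 1 u v; rewrite !scale1r. Qed.

Lemma act_0r D : act D 0 = 0.
Proof. by apply: (addrI (act D 0)); rewrite -act_Dr !addr0. Qed.

Lemma act_Zr c D v : act D (c *: v) = c *: act D v.
Proof. by rewrite -[c *: v]addr0 act_linear act_0r addr0. Qed.

Lemma act_sumr (I : Type) (r : seq I) (P : pred I) (G : I -> N) D :
  act D (\sum_(i <- r | P i) G i) = \sum_(i <- r | P i) act D (G i).
Proof. exact: (big_morph (act D) (act_Dr D) (act_0r D)). Qed.

Lemma act_linearl v : linear (act^~ v).
Proof. by move=> c D E; have [_ [H _]] := actM; exact: H. Qed.

Lemma act_Dl D E v : act (D + E) v = act D v + act E v.
Proof. by have := act_linearl v 1 D E; rewrite !scale1r. Qed.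

Lemma act_0l v : act 0 v = 0.
Proof. by apply: (addrI (act 0 v)); rewrite -act_Dl !addr0. Qed.

Lemma act_comm D E v : act D (act E v) = act E (act D v) + act (brW D E) v.
Proof. by have [_ [_ ->]] := actM; rewrite // addrC subrK. Qed.

End ModuleTheory.

(** * Baby Verma modules and simple modules realised on densities *)

Section BabyVerma.
Variables (F : fieldType) (p : nat).
Hypothesis charp : p \in [pchar F].
Local Notation T := {ffun 'I_p -> F^o}.
Local Notation act s := (@actT F p s).
Local Notation trunc := (@truncp F p).
Implicit Types (g h phi : {poly F}) (D E : Wn F p 1) (u v : T) (s : F).

Let p_gt1 : (1 < p)%N. Proof. exact: prime_gt1 (pcharf_prime charp). Qed.
Let p_gt0 : (0 < p)%N. Proof. exact: ltnW. Qed.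

Lemma truncp_XnM k h : (p <= k)%N -> trunc ('X^k * h) = 0.
Proof. by move=> le; rewrite mulrC (truncp_mulr h (_ : _ = trunc 0)) ?mulr0 ?truncpXn ?linear0. Qed.

Lemma truncp_expand v : v = \sum_(j < p) v j *: trunc 'X^j.
Proof.
by rewrite -[LHS]liftpK linear_sum; apply: eq_bigr => j _; rewrite linearZ.
Qed.

Lemma W1_1P D : W1_1 D -> exists q, D = witt p ('X^2 * q).
Proof.
move=> D1; exists (drop_poly 2 (witt_poly D)).
rewrite -[LHS]witt_polyK; congr witt.
rewrite -[LHS](poly_take_drop 2) mulrC -[RHS]add0r; congr (_ + _).
apply/polyP => i; rewrite coef_take_poly coef0; case: ifP => // lt.
have ip : (i < p)%N by exact: leq_trans p_gt1.
by rewrite (coef_sumXn _ (Ordinal ip)) D1 // ffunE.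
Qed.

(** Fields divisible by x^2 push x^(p-1) into degree p or more, and x d/dx acts on it by p-1+s,
    which is s-1 in characteristic p. *)
Lemma hw_top (lam : nat) : hw (act lam.+1%:R) lam (trunc 'X^(p.-1)).
Proof.
split=> [D /W1_1P[q ->]|].
  rewrite actTE // /rho derivM !derivXn expr1 -[_ *+ p.-1]mulr_natl -[_ *+ 2]mulr_natl.
  have -> : 'X^2 * q * (p.-1%:R * 'X^(p.-1.-1)) = 'X^p * (q * p.-1%:R).
    have -> : 'X^p = 'X^2 * 'X^(p.-1.-1) :> {poly F} by rewrite -exprD; congr ('X^_); lia.
    by ring.
  have -> : (2%:R * 'X * q + 'X^2 * q^`()) * 'X^(p.-1) = 'X^p * (2%:R * q + 'X * q^`()).
    have -> : 'X^p = 'X * 'X^(p.-1) :> {poly F} by rewrite -exprS prednK.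
    by ring.
  by rewrite linearD linearZ /= !truncp_XnM // scaler0 addr0.
rewrite xdW1_witt actTE // -[RHS]linearZ /=; congr trunc.
rewrite /rho derivX derivXn mul1r -mulr_natl mulrCA -exprS.
rewrite (_ : p.-1.-1.+1 = p.-1) -?mul_polyC; last by lia.
rewrite -natr1 -{1}(prednK p_gt0) /= -mulrDl.
have := pcharf0 charp; rewrite -{1}(prednK p_gt0) -natr1 => /eqP.
rewrite addr_eq0 => /eqP E.
have -> : (p.-1%:R : {poly F}) = (p.-1%:R)%:P by rewrite rmorph_nat.
by rewrite E -rmorphD /=; congr (_%:P * _); rewrite addrC addrK.
Qed.

Section Submodules.
Variables (s : F) (U : T -> Prop).
Hypothesis subU : submod (act s) U.

Lemma submodZ c v : U v -> U (c *: v).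
Proof.
by have [[U0 UL] _] := subU => Uv; rewrite -[c *: v]addr0; apply: UL.
Qed.

Lemma submod_sum (I : Type) (r : seq I) (P : pred I) (G : I -> T) :
  (forall i, P i -> U (G i)) -> U (\sum_(i <- r | P i) G i).
Proof.
have [[U0 UL] _] := subU => UG; apply: (big_ind U) => // x y Ux Uy.
by rewrite -[x]scale1r; exact: UL.
Qed.

Lemma submod_rho phi g : U (trunc g) -> U (trunc (rho s phi g)).
Proof. by have [_ UA] := subU => Ug; rewrite -actTE //; exact: UA. Qed.

Lemma submod_unscale c v : c != 0 -> U (c *: v) -> U v.
Proof. by move=> c0 /(submodZ c^-1); rewrite scalerA mulVf // scale1r. Qed.

Lemma submod_top : U (trunc 'X^(p.-1)) -> forall v, U v.
Proof.
move=> top v; rewrite (truncp_expand v); apply: submod_sum => j _; apply: submodZ.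
have gen k : (k < p)%N -> U (trunc 'X^(p.-1 - k)).
  elim: k => [|k IH] lt; first by rewrite subn0.
  have := submod_rho 1 (IH (ltnW lt)).
  rewrite /rho derivC mul0r scaler0 addr0 mul1r derivXn -scaler_nat linearZ /=.
  rewrite -subnS; apply: submod_unscale; apply: (natf_neq0 charp); lia.
by have := gen (p.-1 - j)%N; rewrite subKn; [apply; lia | have := ltn_ord j; lia].
Qed.

(** Differentiating as often as the degree leaves a nonzero constant, since all factors introduced
    lie strictly between 0 and p. *)
Lemma submod_one u : U u -> u != 0 -> U (trunc 1).
Proof.
move=> Uu u0.
have gen k g : (k < p)%N -> (size g <= k.+1)%N -> g`_k != 0 -> U (trunc g) -> U (trunc 1).
  elim: k g => [|k IH] g kp sg gk Ug.
    by move: Ug; rewrite (size1_polyC sg) -[_%:P]mulr1 mul_polyC linearZ; apply: submod_unscale.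
  apply: (IH g^`()); first exact: ltnW.
  - by rewrite -ltnS (leq_trans (lt_size_deriv _)) //; apply: contraNneq gk => ->; rewrite coef0.
  - by rewrite coef_deriv -mulr_natr mulf_neq0 // (natf_neq0 charp).
  - by have := submod_rho 1 Ug; rewrite /rho derivC mul0r scaler0 addr0 mul1r.
have l0 : liftp u != 0 by apply: contraNneq u0 => E; rewrite -[u]liftpK E linear0.
have sz : (size (liftp u) <= p)%N.
  apply: (leq_trans (size_sum _ _ _)); apply/bigmax_leqP => i _.
  by apply: (leq_trans (size_scale_leq _ _)); rewrite size_polyXn.
have szgt : (0 < size (liftp u))%N by rewrite size_poly_gt0.
apply: (gen (size (liftp u)).-1 (liftp u)).
- by rewrite prednK.
- by rewrite prednK.
- by rewrite -/(lead_coef _) lead_coef_eq0.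
- by rewrite liftpK.
Qed.

(** The vector 1 goes to s(j+1)x^j under x^(j+1) d/dx. The factor j+1 excludes only x^(p-1), the
    power that exact one-forms miss. *)
Lemma submod_lower u : s != 0 -> U u -> u != 0 -> forall j, (j.+1 < p)%N -> U (trunc 'X^j).
Proof.
move=> s0 Uu u0 j jp; have := submod_rho 'X^(j.+1) (submod_one Uu u0).
rewrite /rho derivC mulr0 add0r derivXn mulr1 -scaler_nat scalerA linearZ /=.
by apply: submod_unscale; rewrite mulf_neq0 // (natf_neq0 charp).
Qed.

End Submodules.

Lemma simple_actT s : (2 < p)%N -> s != 0 -> s != 1 -> simple_on (act s) (fun _ => True).
Proof.
move=> p2 s0 s1; split; first by [].
split.
  exists (trunc 1); split=> //.
  move/ffunP/(_ (Ordinal p_gt0)); rewrite !ffunE coef1 => /eqP; exact/negP/oner_neq0.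
move=> U' subU _; have [no|yes] := classic (forall u, U' u -> u = 0); first by left.
right=> v _; apply: (submod_top subU).
have [u Uu u0] : exists2 u, U' u & u != 0.
  apply: NNPP => no; apply: yes => u Uu; apply/eqP/negPn/negP => u0; apply: no.
  by exists u.
have p1 : (p.-2.+1 < p)%N by lia.
(* The field x^2 d/dx reaches the missing power: it takes x^(p-2) to x^(p-1) with factor p-2+2s =
   2(s-1), nonzero because s is not 1 and p > 2. *)
have := submod_rho subU 'X^2 (submod_lower subU s0 Uu u0 p1).
have -> : rho s 'X^2 'X^(p.-2) = (2 * (s - 1)) *: 'X^(p.-1).
  rewrite /rho !derivXn expr1 -[_ *+ p.-2]mulr_natl -[_ *+ 2]mulr_natl -!mul_polyC.
  have -> : 'X^(p.-1) = 'X * 'X^(p.-2) :> {poly F} by rewrite -exprS; congr ('X^_); lia.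
  have -> : (p.-2%:R : {poly F}) = (-2)%:P.
    rewrite -(rmorph_nat (@polyC F)); congr (_%:P); apply/eqP.
    rewrite -subr_eq0 opprK -natrD (_ : (p.-2 + 2)%N = p) ?pcharf0 //; lia.
  case: (posnP p.-2) => [|lt]; first lia.
  have -> : 'X^(p.-2) = 'X * 'X^(p.-2.-1) :> {poly F} by rewrite -exprS; congr ('X^_); lia.
  by ring.
rewrite linearZ; apply: (submod_unscale subU).
by rewrite mulf_neq0 // ?subr_eq0 // (natf_neq0 charp).
Qed.

Definition exactT v : Prop := exists g, v = trunc g^`().

(** Termwise integration divides the coefficient of x^i by i+1, which is impossible exactly for i =
    p-1. *)
Lemma exactTP v : exactT v <-> forall i : 'I_p, i.+1 = p -> v i = 0.
Proof.
split=> [[g ->] i E|H]; first by rewrite ffunE coef_deriv E mulrn_pchar.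
exists (\poly_(i < p) (if i is j.+1 then (liftp v)`_j / j.+1%:R else 0)).
apply/ffunP => a; rewrite ffunE coef_deriv coef_poly.
case: ltnP => [lt|le].
  rewrite -[RHS]mulr_natr divfK; last by rewrite (natf_neq0 charp).
  by rewrite coef_sumXn.
by rewrite mul0rn H //; apply/eqP; rewrite eqn_leq le ltn_ord.
Qed.

(** Stability holds because phi d/dx sends the one-form g' to (phi g')'. Simplicity holds because
    the powers given by [submod_lower], all x^j with j < p-1, already span the exact forms. *)
Lemma simple_exactT : simple_on (act 1) exactT.
Proof.
have subE : submod (act 1) exactT.
  split; first split.
  - by exists 0; rewrite deriv0 linear0.
  - by move=> c u v [g ->] [h ->]; exists (c *: g + h); rewrite derivD derivZ linearP.
  - move=> D u [g ->]; exists (witt_poly D * g^`()).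
    rewrite -{1}[D]witt_polyK actTE // /rho derivM scale1r addrC.
    by congr trunc; rewrite addrC.
split=> //; split.
  exists (trunc 1); split; first by exists 'X; rewrite derivX.
  move/ffunP/(_ (Ordinal p_gt0)); rewrite !ffunE coef1 => /eqP; exact/negP/oner_neq0.
move=> U' subU _; have [no|yes] := classic (forall u, U' u -> u = 0); first by left.
right=> v /exactTP Ev.
have [u Uu u0] : exists2 u, U' u & u != 0.
  apply: NNPP => no; apply: yes => u Uu; apply/eqP/negPn/negP => u0; apply: no.
  by exists u.
rewrite (truncp_expand v); apply: (submod_sum subU) => j _.
case: (leqP p j.+1) => [le|lt].
  rewrite Ev ?scale0r; first by have [[]] := subU.
  by apply/eqP; rewrite eqn_leq le ltn_ord.
by apply: (submodZ subU); apply: (submod_lower subU _ Uu u0); rewrite ?oner_neq0.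
Qed.

Section Universal.
Variables (lam : nat) (N : lmodType F) (actN : Wn F p 1 -> N -> N) (w : N).
Hypotheses (actNM : module_on actN (fun _ => True))
  (actNR : restricted_on actN (fun _ => True)) (hww : hw actN lam w).
Local Notation d := (witt p 1).
Local Notation s := (lam.+1%:R : F).

(* [vermaN k] is the image of x^(p-1-k) under the map sending x^(p-1) to w. *)
Fixpoint vermaN k : N :=
  if k is k'.+1 then ((p.-1 - k')%:R)^-1 *: actN d (vermaN k') else w.

Definition vermaG g : N := \sum_(j < p) g`_j *: vermaN (p.-1 - j).

Lemma vermaG_is_linear : linear vermaG.
Proof.
move=> c g h; rewrite /vermaG scaler_sumr -big_split; apply: eq_bigr => j _ /=.
by rewrite coefD coefZ scalerDl scalerA.
Qed.
HB.instance Definition _ := GRing.isLinear.Build F {poly F} N _ vermaG vermaG_is_linear.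

Lemma vermaG_truncp g h : trunc g = trunc h -> vermaG g = vermaG h.
Proof. by move=> E; apply: eq_bigr => j _; rewrite (truncp_coef E). Qed.

Lemma vermaG_Xn j : (j < p)%N -> vermaG 'X^j = vermaN (p.-1 - j).
Proof.
move=> lt; rewrite /vermaG (bigD1 (Ordinal lt)) //= coefXn eqxx scale1r big1 ?addr0 // => i ne.
by rewrite coefXn (_ : _ == _ = false) ?scale0r //; apply: negbTE.
Qed.

(** The derivation d/dx of F[x]/(x^p) has p-th power 0, and a restricted action preserves this. *)
Lemma actN_d_iter : iter p (actN d) w = 0.
Proof.
rewrite -actNR // pmapW_witt // (_ : iter p _ _ = 0) ?linear0 ?act_0l //.
have -> : p = p.-2.+2 by lia.
rewrite 2!iterSr derivX !mul1r derivC.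
by elim: p.-2 => //= k ->; rewrite deriv0 mulr0.
Qed.

Lemma actN_d_last : actN d (vermaN p.-1) = 0.
Proof.
have H k : exists c : F, vermaN k = c *: iter k (actN d) w.
  elim: k => [|k [c IH]] /=; first by exists 1; rewrite scale1r.
  by exists (((p.-1 - k)%:R)^-1 * c); rewrite IH (act_Zr actNM) scalerA.
have [c ->] := H p.-1.
by rewrite (act_Zr actNM) /= -iterS prednK // actN_d_iter scaler0.
Qed.

Lemma actN_dG g : actN d (vermaG g) = vermaG g^`().
Proof.
have Xn j : actN d (vermaG 'X^j) = vermaG ('X^j)^`().
  rewrite derivXn; case: (ltnP j p) => [lt|le]; last first.
    rewrite (vermaG_truncp (_ : _ = trunc 0)) ?linear0 ?truncpXn //.
    rewrite act_0r //; move: le; rewrite leq_eqVlt => /orP[/eqP<-|lt].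
      by rewrite -scaler_nat pcharf0 // scale0r linear0.
    rewrite (vermaG_truncp (_ : _ = trunc 0)) ?linear0 // linearMn /=.
    by rewrite truncpXn ?mul0rn //; lia.
  (* For j = 0 the derivative is 0, and on the other side [actN d] meets the last vector
     [vermaN p.-1], which restrictedness kills. *)
  case: j lt => [|j] lt; first by rewrite mulr0n linear0 vermaG_Xn // subn0 actN_d_last.
  rewrite -scaler_nat linearZ /= !vermaG_Xn //; last exact: ltnW.
  have -> : (p.-1 - j = (p.-1 - j.+1).+1)%N by lia.
  rewrite /= (_ : p.-1 - (p.-1 - j.+1) = j.+1)%N; last by lia.
  by rewrite scalerA mulfV ?scale1r // (natf_neq0 charp).
rewrite -[g]coefK poly_def !linear_sum act_sumr //; apply: eq_bigr => j _ /=.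
by rewrite derivZ !linearZ /= act_Zr // Xn.
Qed.

(* On x^(p-1) only the coefficients of 1 and x in phi matter; going down from x^(j+1)
   to x^j uses that both sides are Lie actions agreeing on d/dx. *)
Lemma actN_vermaG phi g : actN (witt p phi) (vermaG g) = vermaG (rho s phi g).
Proof.
have [hw1 hw2] := hww.
have Xn k : (k < p)%N -> forall f, actN (witt p f) (vermaG 'X^(p.-1 - k)) =
    vermaG (rho s f 'X^(p.-1 - k)).
  elim: k => [_ f|k IH lt f].
    rewrite subn0.
    have Gw : vermaG 'X^(p.-1) = w by rewrite vermaG_Xn ?subnn // prednK.
    have base c1 c2 q : actN (witt p (c1 *: 1 + (c2 *: 'X + 'X^2 * q))) (vermaG 'X^(p.-1))
        = vermaG (rho s (c1 *: 1 + (c2 *: 'X + 'X^2 * q)) 'X^(p.-1)).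
      rewrite !(linearP (@witt F p)) !(act_linearl actNM) !rho_linearl !linearP /=.
      congr (_ *: _ + (_ *: _ + _)).
      - by rewrite actN_dG /rho derivC mul0r scaler0 addr0 mul1r.
      - have [_ E] := hw_top lam; move: E; rewrite xdW1_witt actTE // -linearZ /=.
        move/vermaG_truncp->; rewrite linearZ /= Gw -xdW1_witt; exact: hw2.
      - have [E _] := hw_top lam; have := E _ (@W1_1_witt F p q); rewrite actTE //.
        rewrite -(linear0 trunc) => /vermaG_truncp->; rewrite linear0 Gw.
        by apply: hw1; exact: W1_1_witt.
    suff -> : f = f`_0 *: 1 + (f`_1 *: 'X + 'X^2 * drop_poly 2 f) by exact: base.
    rewrite -{1}[f](poly_take_drop 2) mulrC addrA; congr (_ + _).
    apply/polyP => i; rewrite coef_take_poly coefD !coefZ coef1 coefX.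
    by case: i => [|[|i]] //=; rewrite ?mulr0 ?mulr1 ?addr0 ?add0r.
  have {}IH := IH (ltnW lt).
  set j := (p.-1 - k.+1)%N.
  have Ej : (p.-1 - k = j.+1)%N by rewrite /j; lia.
  have j0 : (j.+1)%:R != 0 :> F by rewrite (natf_neq0 charp) // /j; lia.
  have Xj : 'X^j = (j.+1%:R)^-1 *: rho s 1 'X^(j.+1) :> {poly F}.
    rewrite /rho derivC mul0r scaler0 addr0 mul1r derivXn -scaler_nat scalerA.
    by rewrite mulVf // scale1r.
  rewrite Ej in IH.
  rewrite {}Xj !linearZ /= act_Zr //; congr (_ *: _).
  rewrite -IH act_comm // IH brW_witt // IH actN_dG rho_lie linearB /=.
  rewrite addrCA -[RHS]addr0; congr (_ + _); apply/eqP; rewrite subr_eq0; apply/eqP.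
  by congr vermaG; rewrite [in RHS]/rho derivC mul0r scaler0 addr0 mul1r.
rewrite (_ : vermaG g = \sum_(j < p) g`_j *: vermaG 'X^j); last first.
  by apply: eq_bigr => j _; rewrite vermaG_Xn.
rewrite act_sumr // (vermaG_truncp (_ : _ = trunc (rho s phi (liftp (trunc g))))); last first.
  by apply: rho_truncp => //; rewrite liftpK.
rewrite /liftp !linear_sum; apply: eq_bigr => j _; rewrite act_Zr // !linearZ /= ffunE.
congr (_ *: _); have -> : (j : nat) = (p.-1 - (p.-1 - j))%N by have := ltn_ord j; lia.
by apply: Xn; lia.
Qed.

Lemma vermaG_hom : hom_on (act s) actN (fun _ => True) (vermaG \o @liftp F p).
Proof.
split=> [c u v _ _|D u _] /=; first by rewrite !linearP.
rewrite -{2}[D]witt_polyK actN_vermaG; apply: vermaG_truncp; exact: liftpK.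
Qed.

Lemma vermaG_top : vermaG (liftp (trunc 'X^(p.-1))) = w.
Proof.
rewrite (vermaG_truncp (_ : _ = trunc 'X^(p.-1))) ?liftpK //.
by rewrite vermaG_Xn ?subnn // prednK.
Qed.

End Universal.

Lemma verma_actT (lam : nat) : verma_sub lam (act lam.+1%:R) (fun _ => True).
Proof.
split; first by [].
split; first exact: actT_module.
split; first exact: actT_restricted.
exists (trunc 'X^(p.-1)); split=> //; split; first exact: hw_top.
move=> N actN w actNM actNR hww; split.
  exists (vermaG actN w \o @liftp F p); split; first exact: vermaG_hom hww.
  exact: vermaG_top.
move=> f g [fL fA] [gL gA] fv gv u _.
(* The vectors on which two homomorphisms agree form a submodule, and it contains the generator
   x^(p-1). *)
apply: (@submod_top lam.+1%:R (fun u => f u = g u)); last by rewrite fv gv.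
have at0 (k : {ffun 'I_p -> F^o} -> N) : (forall (a : F) u u', True -> True ->
    k (a *: u + u') = a *: k u + k u') -> k 0 = 0.
  by move=> kL; have := kL (-1) 0 0 I I; rewrite scaler0 addr0 scaleN1r addNr.
split; first split; first by rewrite !at0.
- by move=> c x y Ex Ey; rewrite fL // gL // Ex Ey.
- by move=> D x Ex; rewrite fA // gA // Ex.
Qed.

End BabyVerma.

(** * Carrying module properties along an embedding of T_s *)

Section Transport.
Variables (F : fieldType) (p : nat) (V : lmodType F) (actV : Wn F p 1 -> V -> V).
Hypothesis charp : p \in [pchar F].
Local Notation T := {ffun 'I_p -> F^o}.
Variables (s : F) (iota : T -> V) (kappa : V -> T).
Hypotheses (iotaL : linear iota) (kappaL : linear kappa) (iotaK : cancel iota kappa)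
  (iotaA : forall D v, actV D (iota v) = iota (actT s D v)).

Definition image_of (U : T -> Prop) (x : V) : Prop := exists2 v, U v & x = iota v.

Let iota0 : iota 0 = 0.
Proof. by have := iotaL (-1) 0 0; rewrite scaler0 addr0 scaleN1r addNr. Qed.

Let iotaB u v : iota (u - v) = iota u - iota v.
Proof. by rewrite [u - v]addrC -[- v]scaleN1r iotaL scaleN1r addrC. Qed.

Lemma image_submod U : submod (actT s) U -> submod actV (image_of U).
Proof.
move=> [[U0 UL] UA]; split; first split.
- by exists 0.
- by move=> a _ _ [u Uu ->] [v Uv ->]; exists (a *: u + v); [exact: UL | rewrite iotaL].
- by move=> D _ [u Uu ->]; exists (actT s D u); [exact: UA | exact: iotaA].
Qed.

Lemma image_module U : module_on actV (image_of U).
Proof.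
have [m1 [m2 m3]] := actT_module charp s.
split=> [D a _ _ [u _ ->] [v _ ->]|]; first by rewrite -iotaL !iotaA m1 // iotaL.
split=> [D E a _ [v _ ->]|D E _ [v _ ->]]; first by rewrite !iotaA m2 // iotaL.
by rewrite !iotaA m3 // iotaB.
Qed.

Hypothesis (k : nat) (sE : s = k%:R).

Lemma image_restricted U : restricted_on actV (image_of U).
Proof.
move=> D _ [v _ ->]; rewrite iotaA sE (actT_restricted charp) // -sE.
have gen j : iter j (actV D) (iota v) = iota (iter j (actT s D) v).
  by elim: j => //= j ->; rewrite iotaA.
exact/esym/gen.
Qed.

(** A [hom_on] is a function on the whole space, constrained only on the submodule. A homomorphism
    on [T] is therefore extended by the linear retraction [kappa]. *)
Lemma image_verma (lam : nat) : s = lam.+1%:R -> verma_sub lam actV (image_of (fun _ => True)).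
Proof.
move=> sl; split; first exact: image_submod.
split; first exact: image_module.
split; first exact: image_restricted.
have [_ [_ [_ [v0 [_ [[h1 h2] univ]]]]]] := verma_actT charp lam.
rewrite -sl in h1 h2 univ.
have iotaZ c v : iota (c *: v) = c *: iota v by rewrite -[c *: v]addr0 iotaL iota0 addr0.
exists (iota v0); split; first by exists v0.
split.
  split=> [D D1|]; first by rewrite iotaA h1.
  by rewrite iotaA h2 iotaZ.
move=> N actN w mN rN hN; have [[f [[fL fA] fv]] uniq] := univ N actN w mN rN hN.
split.
  exists (f \o kappa); split; last by rewrite /= iotaK.
  split=> [a _ _ [u _ ->] [u' _ ->]|D _ [u _ ->]] /=; first by rewrite kappaL fL.
  by rewrite iotaA !iotaK fA.
have pull h : hom_on actV actN (image_of (fun _ => True)) h ->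
    hom_on (actT s) actN (fun _ => True) (h \o iota).
  move=> [hL hA]; split=> [a u u' _ _|D u _] /=.
    by rewrite iotaL hL //; [exists u | exists u'].
  by rewrite -iotaA hA //; exists u.
move=> g h gH hH gv hv _ [u _ ->].
exact: (uniq (g \o iota) (h \o iota) (pull g gH) (pull h hH)).
Qed.

Lemma image_simple U : simple_on (actT s) U -> simple_on actV (image_of U).
Proof.
move=> [subU [[u [Uu u0]] simp]]; split; first exact: image_submod.
split.
  exists (iota u); split; first by exists u.
  by move=> E; apply: u0; rewrite -[u]iotaK E -iota0 iotaK.
move=> U' [[U'0 U'L] U'A] sub.
have [||no|all] := simp (fun v => U' (iota v)).
- split; first split; first by rewrite iota0.
    by move=> a x y Ux Uy; rewrite iotaL; exact: U'L.
  by move=> D x Ux; rewrite -iotaA; exact: U'A.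
- move=> v /sub[v' Uv' E]; have -> : v = v' by rewrite -[v]iotaK E iotaK.
  by [].
- by left=> x Ux; have [v _ E] := sub x Ux; rewrite E (no v) ?iota0 // -E.
- by right=> _ [v Uv ->]; exact: all.
Qed.

(** The map [gg] presents [U] as a quotient of T_(lam+1), which is V(lam). *)
Lemma image_simpleL (lam : nat) U (gg : T -> T) :
  simple_on (actT s) U ->
  hom_on (actT lam.+1%:R) (actT s) (fun _ => True) gg ->
  (forall v, U v <-> exists y, v = gg y) ->
  simpleL_sub lam actV (image_of U).
Proof.
move=> simp [gL gA] gU; split; first exact: image_module.
split; first exact: image_restricted.
split; first exact: image_simple.
exists T, (actT lam.+1%:R); split; first exact: verma_actT.
exists (iota \o gg); split.
  split=> [a u u' _ _|D u _] /=; first by rewrite gL // iotaL.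
  by rewrite gA // iotaA.
move=> x; split=> [[v /gU[y ->] ->]|[y ->]]; first by exists y.
by exists (gg y) => //; apply/gU; exists y.
Qed.

End Transport.

(** * The action through Theta_S on fields g(x_1) x^e d_j *)

Section Embeddings.
Variables (F : fieldType) (p r : nat).
Hypothesis charp : p \in [pchar F].
Local Notation m := r.+1.
Local Notation n := r.+2.
Local Notation x2 := (lift ord0 ord0 : 'I_n).
Implicit Types (f g : {poly F}) (j : 'I_m).

Lemma embA_polyA g :
  embA n (polyA (fun=> 0%N) g : Alg F p 1) = polyA (fun=> 0%N) g.
Proof.
apply/ffunP => al; rewrite !ffunE (bigD1 ([ffun=> al ord0] : mon p 1)) //= big1 ?addr0; last first.
  move=> be ne; case: ifP => // /forallP /(_ ord0) /= /eqP E; case/eqP: ne.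
  by apply/ffunP => k; rewrite ffunE (ord1 k); apply/val_inj.
rewrite forall_ord0 ffunE /= eqxx /= ffunE; case: (X in if X then _ else _) => //.
by case: forallP => [_|[[]]]; rewrite ?ffunE.
Qed.

Lemma ThetaS_witt f : ThetaS n (witt p f) =
  dW ord0 (polyA (fun=> 0%N) f) - dW x2 (polyA (fun k : 'I_m => k == ord0 : nat) f^`()).
Proof.
have dWB (A B : Alg F p n) (i : 'I_n) : (dW ord0 A - dW x2 B) i =
    (if i == ord0 then A else 0) - (if i == x2 then B else 0) by rewrite !ffunE.
apply/ffunP => j; rewrite dWB ffunE {dWB}.
have -> : witt p f ord0 = polyA (fun=> 0%N) f by rewrite ffunE eqxx.
rewrite polyA_der0 // !embA_polyA.
case: (unliftP ord0 j) => [k|] -> /=; last by rewrite subr0.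
rewrite (inj_eq lift_inj) add0r; case: (eqVneq k ord0) => [->|ne] /=.
  rewrite (_ : monoA F p _ = polyA (fun k : 'I_m => k == ord0 : nat) 'X^0).
    by rewrite polyA_mul mul1r; congr (- _); apply: eq_polyA => l; rewrite addn0.
  by rewrite polyA_Xn; apply: eq_monoA => l; rewrite /mexp; case: unliftP => [i|] ->.
by case: ifP => [/eqP E|_]; [case/eqP: ne; apply/val_inj; move: E; rewrite /= /bump /=; lia | rewrite oppr0].
Qed.

(** The weight comes from the part -f' x_2 d_2 of Theta: it differentiates x^e, which gives minus
    [e ord0], and its factor x_2 is differentiated by the field when j is x_2, which gives +1. *)
Lemma actS_dWS f (e : 'I_m -> nat) g j :
  actS (witt p f) (dW (lift ord0 j) (polyA e g) : Wn F p n) =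
  dW (lift ord0 j) (polyA e (rho ((j == ord0)%:R - (e ord0)%:R) f g)).
Proof.
rewrite /actS ThetaS_witt brWDl brWNl !brW_dW polyA_der0 // !polyA_derS // scale0r.
rewrite linear0 linear0 subr0 polyA_mul !mulAZr !polyA_mul opprB addrA.
have -> : (e ord0)%:R *: polyA (fun k : 'I_m => (k == ord0) + decr ord0 e k)%N (f^`() * g)
    = (e ord0)%:R *: polyA e (f^`() * g) :> Alg F p n.
  case: (posnP (e ord0)) => [->|pos]; first by rewrite !scale0r.
  congr (_ *: _); apply: eq_polyA => k; rewrite /decr; case: (eqVneq k ord0) => [->|_]; lia.
rewrite /rho; case: (eqVneq j ord0) => [->|ne] /=.
  rewrite scale1r (@eq_polyA _ _ _ (fun k => e k + _)%N e) => [|k]; last by rewrite /decr subnn addn0.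
  rewrite (@eq_polyA _ _ _ (fun k => 0 + e k)%N e) // -linearD -linearB; congr dW.
  by rewrite -polyAZ -linearD -linearB; congr polyA; rewrite -!mul_polyC; ring.
rewrite scale0r linear0 addr0 -linearB; congr dW.
rewrite (@eq_polyA _ _ _ (fun k => 0 + e k)%N e) // -polyAZ -linearB.
by congr polyA; rewrite -!mul_polyC; ring.
Qed.

(** As a vector field in x_1, g d_1 contributes the weight -1. The second summand arises because d_1
    also differentiates the coefficient f' of x_2 d_2 in Theta. *)
Lemma actS_dW0 f (e : 'I_m -> nat) g :
  actS (witt p f) (dW ord0 (polyA e g) : Wn F p n) =
  dW ord0 (polyA e (rho (-1 - (e ord0)%:R) f g)) +
  dW x2 (polyA (incr ord0 e) (f^`()^`() * g)).
Proof.
rewrite /actS ThetaS_witt brWDl brWNl !brW_dW !polyA_der0 // !polyA_derS //.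
rewrite !mulAZr !polyA_mul opprB.
have -> : (e ord0)%:R *: polyA (fun k : 'I_m => (k == ord0) + decr ord0 e k)%N (f^`() * g)
    = (e ord0)%:R *: polyA e (f^`() * g) :> Alg F p n.
  case: (posnP (e ord0)) => [->|pos]; first by rewrite !scale0r.
  congr (_ *: _); apply: eq_polyA => k; rewrite /decr; case: (eqVneq k ord0) => [->|_]; lia.
rewrite (@eq_polyA _ _ _ (fun k => 0 + e k)%N e) //.
rewrite (@eq_polyA _ _ _ (fun k => e k + 0)%N e) => [|k]; last by rewrite addn0.
rewrite [g * f^`()^`()]mulrC addrCA addrC -linearB -linearB; congr (_ + _); congr dW.
by rewrite -polyAZ -!linearB; congr polyA; rewrite /rho -!mul_polyC; ring.
Qed.

End Embeddings.

(** * Combinatorics of pivots and corners *)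

Section Pivots.
Variables (p m : nat).
Implicit Types (e d : mon p m) (j k q : 'I_m).

Definition decm j e : mon p m :=
  [ffun k => Ordinal (leq_ltn_trans (leq_subr (k == j) (e k)) (ltn_ord (e k)))].

Lemma decmE j e k : decm j e k = (e k - (k == j))%N :> nat.
Proof. by rewrite ffunE. Qed.

(** An index q stands for the variable x_(q+2), so [ord0] is x_2. Minimality makes q unique and
    gives x_2 priority. *)
Definition is_piv d q := ((d q).+1 < p)%N && [forall l : 'I_m, (l < q)%N ==> ((d l).+1 == p)].

Lemma is_piv_uniq d q q' : is_piv d q -> is_piv d q' -> q = q'.
Proof.
move=> /andP[lt /forallP H] /andP[lt' /forallP H'].
apply/val_inj/eqP; case: (ltngtP (q : nat) q') => // c.
  by have := H' q; rewrite c /= => /eqP E; move: lt; rewrite E ltnn.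
by have := H q'; rewrite c /= => /eqP E; move: lt'; rewrite E ltnn.
Qed.

Lemma is_piv_ex d k : ((d k).+1 < p)%N -> exists2 q, is_piv d q & (q <= k)%N.
Proof.
move=> lt; have [q lq min] := @arg_minnP _ k (fun k => ((d k).+1 < p)%N) (@nat_of_ord m) lt.
exists q; last exact: min.
apply/andP; split=> //; apply/forallP => l; apply/implyP => lq'.
by rewrite eqn_leq ltn_ord /= leqNgt; apply/negP => /min; rewrite leqNgt lq'.
Qed.

(* The pair (j, e) is pivotal when x^e d_j is the correction that makes some multiple of
   x^(e - eps_j) d_1 divergence-free. *)
Definition pivotal (x : 'I_m * mon p m) :=
  (0 < x.2 x.1)%N && is_piv (decm x.1 x.2) x.1.

Lemma pivotalE j e : pivotal (j, e) =
  (0 < e j)%N && [forall l : 'I_m, (l < j)%N ==> ((e l).+1 == p)].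
Proof.
rewrite /pivotal /=; case: (posnP (e j)) => //= pos; rewrite /is_piv decmE eqxx subn1 prednK // ltn_ord /=.
apply: eq_forallb => l; case: (ltnP l j) => //= lt.
by rewrite decmE (_ : (l == j) = false) ?subn0 //; apply/negbTE; rewrite neq_ltn lt.
Qed.

(** The index is recovered as the unique pivot of the lowered exponent vector, and raising at that
    index recovers e. *)
Lemma pivotal_inj j e j' e' : pivotal (j, e) -> pivotal (j', e') -> decm j e = decm j' e' ->
  (j, e) = (j', e').
Proof.
move=> /andP[/= pos P1] /andP[/= pos' P2] E; rewrite -E in P2.
have Ej := is_piv_uniq P1 P2; rewrite -{j' P1 P2}Ej in pos' E *; congr pair.
apply/ffunP => k; apply/val_inj; have := congr1 (fun d : mon p m => d k : nat) E.
by rewrite /= !decmE; case: eqP => [->|_] /=; lia.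
Qed.

(** Some exponent before j is below p-1, since otherwise j itself would be the pivot. *)
Lemma nonpivotal_piv j e : ~~ pivotal (j, e) -> (0 < e j)%N ->
  exists2 q, is_piv (decm j e) q & (q < j)%N.
Proof.
rewrite pivotalE => np pos; move: np; rewrite pos /= negb_forall => /existsP[l].
rewrite negb_imply => /andP[lj ne].
have lne : l != j by rewrite neq_ltn lj.
have [|q P1 ql] := @is_piv_ex (decm j e) l.
  by rewrite decmE (negPf lne) subn0 ltn_neqAle ne ltn_ord.
by exists q => //; exact: leq_ltn_trans lj.
Qed.

Lemma pivotal_incr d q : is_piv d q -> exists2 e : mon p m, pivotal (q, e) &
  (forall k, e k = incr q (fun k => d k) k :> nat) /\ decm q e = d.
Proof.
move=> Pq; have /andP[lt _] := Pq.
have lt' k : (incr q (fun k => d k) k < p)%N.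
  by rewrite /incr; case: eqP => [->|_] /=; rewrite ?addn1 ?addn0.
exists [ffun k => Ordinal (lt' k)]; last first.
  split=> [k|]; first by rewrite ffunE.
  by apply/ffunP => k; apply/val_inj; rewrite /= decmE ffunE /= /incr addnK.
apply/andP; split; first by rewrite /= ffunE /= /incr eqxx addn1.
rewrite /= (_ : decm q _ = d) //.
by apply/ffunP => k; apply/val_inj; rewrite /= decmE ffunE /= /incr addnK.
Qed.

(* The pairs whose slice of S(n) is L(p-1): x^e is the product of all (p-1)-st powers
   of the variables other than x_1 and the one of index j. *)
Definition corner (x : 'I_m * mon p m) :=
  [forall k, if k == x.1 then x.2 k == 0 :> nat else (x.2 k).+1 == p].

Lemma corner_nonpivotal x : corner x -> ~~ pivotal x.
Proof. by move=> /forallP /(_ x.1); rewrite eqxx /pivotal => /eqP->. Qed.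

End Pivots.

(** * Decomposition of S(n) into density modules *)

Lemma scale_addB (F : fieldType) (V : lmodType F) (c a : F) (u u' v v' : V) :
  c *: u + u' - a *: (c *: v + v') = c *: (u - a *: v) + (u' - a *: v').
Proof. by rewrite scalerDr scalerBr opprD addrACA !scalerA [a * c]mulrC. Qed.

Lemma big_delta (V : nmodType) (I : finType) (x : I) (G : I -> V) :
  \sum_y (if x == y then G y else 0) = G x.
Proof. by rewrite -big_mkcond (big_pred1 x) // => y; rewrite eq_sym. Qed.

Section Decomposition.
Variables (F : fieldType) (p r : nat).
Hypothesis charp : p \in [pchar F].
Local Notation m := r.+1.
Local Notation n := r.+2.
Local Notation T := {ffun 'I_p -> F^o}.
Local Notation J := ('I_m * mon p m)%type.
Local Notation trunc := (@truncp F p).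
Local Notation x2 := (lift ord0 ord0 : 'I_n).
Local Notation P e := (@polyA F p m (fun k => e k : nat)).
Implicit Types (f g h : {poly F}) (j q : 'I_m) (e d : mon p m) (v : T) (x y : J).

(** The default is reached only when all exponents of d are p-1. The scalar in [primW] is then the
    inverse of p = 0, which is 0 by convention, so [primW d] vanishes. *)
Definition piv d : 'I_m := odflt ord0 [pick q | is_piv d q].

Lemma pivE d q : is_piv d q -> piv d = q.
Proof.
by rewrite /piv; case: pickP => [q' P1 P2|/(_ q)->//]; exact: is_piv_uniq P1 P2.
Qed.

(* A field of divergence h x^d, provided some exponent in d is not p-1. *)
Definition primW d h : Wn F p n :=
  ((d (piv d)).+1%:R)^-1 *: dW (lift ord0 (piv d)) (polyA (incr (piv d) (fun k => d k)) h).

Lemma primW_is_linear d : linear (primW d).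
Proof.
move=> c f g; by rewrite /primW polyA_is_linear dW_is_linear scalerDr !scalerA mulrC.
Qed.
HB.instance Definition _ d :=
  GRing.isLinear.Build F {poly F} (Wn F p n) _ (primW d) (primW_is_linear d).

Lemma primWZ d c h : primW d (c *: h) = c *: primW d h.
Proof. exact: linearZ. Qed.

Lemma primWN d h : primW d (- h) = - primW d h.
Proof. exact: linearN. Qed.

Lemma primWB d h h' : primW d (h - h') = primW d h - primW d h'.
Proof. exact: linearB. Qed.

(** A pivotal pair carries the d_1-field of degree d, because its own field serves as the correction
    there. When [x.2 x.1 = 0] no degree is lowered, but the coefficient of the correction is 0. *)
Definition embJ x g : Wn F p n :=
  let d := decm x.1 x.2 in
  if pivotal x then dW ord0 (P d g) - primW d g^`()
  else dW (lift ord0 x.1) (P x.2 g) - (x.2 x.1)%:R *: primW d g.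

Definition wtJ x : F :=
  if pivotal x then -1 - (decm x.1 x.2 ord0)%:R
  else (x.1 == ord0)%:R - (x.2 ord0)%:R.

Lemma embJ_pivotal x g : pivotal x ->
  embJ x g = dW ord0 (P (decm x.1 x.2) g) - primW (decm x.1 x.2) g^`().
Proof. by rewrite /embJ => ->. Qed.

Lemma embJ_nonpivotal x g : ~~ pivotal x ->
  embJ x g = dW (lift ord0 x.1) (P x.2 g) - (x.2 x.1)%:R *: primW (decm x.1 x.2) g.
Proof. by rewrite /embJ => /negbTE ->. Qed.

Lemma embJ_is_linear x : linear (embJ x).
Proof.
move=> c f g; case: (boolP (pivotal x)) => Px.
  rewrite !(embJ_pivotal _ Px) derivD derivZ polyA_is_linear dW_is_linear primW_is_linear.
  by rewrite -[X in _ - X]scale1r scale_addB !scale1r.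
rewrite !(embJ_nonpivotal _ Px) polyA_is_linear dW_is_linear primW_is_linear.
exact: scale_addB.
Qed.
HB.instance Definition _ x :=
  GRing.isLinear.Build F {poly F} (Wn F p n) _ (embJ x) (embJ_is_linear x).

Lemma embJ_truncp x g h : trunc g = trunc h -> embJ x g = embJ x h.
Proof.
move=> E; case: (boolP (pivotal x)) => Px.
  rewrite !(embJ_pivotal _ Px) /primW (eq_truncp_polyA _ E).
  by rewrite (eq_truncp_polyA _ (truncp_deriv charp E)).
by rewrite !(embJ_nonpivotal _ Px) /primW !(eq_truncp_polyA _ E).
Qed.

Lemma actS_linear D : linear (@actS F p n D).
Proof. by move=> c u v; rewrite /actS brW_linear. Qed.
HB.instance Definition _ D :=
  GRing.isLinear.Build F (Wn F p n) (Wn F p n) _ (@actS F p n D) (actS_linear D).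

Lemma actSZ D c E : actS D (c *: E) = c *: actS D E :> Wn F p n.
Proof. exact: linearZ. Qed.

Lemma actSB D E E' : actS D (E - E') = actS D E - actS D E' :> Wn F p n.
Proof. exact: linearB. Qed.

Lemma actS_primW f d h :
  actS (witt p f) (primW d h) = primW d (rho (- (d ord0)%:R) f h).
Proof.
rewrite /primW actSZ actS_dWS //.
have -> : (piv d == ord0)%:R - (incr (piv d) (fun k => d k) ord0)%:R = - (d ord0)%:R :> F.
  by rewrite /incr natrD opprD addrCA [ord0 == _]eq_sym subrr addr0.
by [].
Qed.

(** If x_2 has exponent below p-1 it is the pivot; otherwise the left side is 0 by truncation and
    the right side because p = 0. This absorbs the extra term of [actS_dW0]. *)
Lemma dW_x2_primW d h :
  dW x2 (polyA (incr ord0 (fun k => d k)) h) = (d ord0).+1%:R *: primW d h.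
Proof.
case: (ltnP (d ord0).+1 p) => [lt|le].
  have P0 : is_piv d ord0 by rewrite /is_piv lt; apply/forallP.
  by rewrite /primW (pivE P0) scalerA mulfV ?scale1r // (natf_neq0 charp).
have E : (d ord0).+1 = p by apply/eqP; rewrite eqn_leq le ltn_ord.
rewrite E pcharf0 // scale0r (@polyA_oor _ _ _ _ ord0) ?linear0 //.
by rewrite /incr eqxx addn1.
Qed.

Lemma actS_embJ f x g : actS (witt p f) (embJ x g) = embJ x (rho (wtJ x) f g).
Proof.
case: (boolP (pivotal x)) => Px; rewrite /wtJ.
  rewrite Px !(embJ_pivotal _ Px); set d := decm x.1 x.2.
  rewrite actSB actS_dW0 // actS_primW dW_x2_primW -addrA.
  (* The term in f'' g turns the action on g' into the derivative of the action on g, so the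
     corrected field keeps its shape. *)
  have -> : (d ord0).+1%:R *: primW d (f^`()^`() * g) - primW d (rho (- (d ord0)%:R) f g^`()) =
      - primW d (rho (-1 - (d ord0)%:R) f g)^`().
    rewrite -primWZ -primWB -primWN.
    have -> : (d ord0).+1%:R *: (f^`()^`() * g) - rho (- (d ord0)%:R) f g^`() =
        - (rho (-1 - (d ord0)%:R) f g)^`().
      by rewrite /rho !(derivD, derivZ, derivM) -!mul_polyC -natr1; ring.
    by [].
  by [].
rewrite (negPf Px) !(embJ_nonpivotal _ Px) actSB actS_dWS // actSZ.
case: (posnP (x.2 x.1)) => [->|pos]; first by rewrite !scale0r.
case: x Px pos => j e Px /= pos; have [q _ qj] := nonpivotal_piv Px pos.
(* The pivot precedes j, so j is not x_2. Hence x_2 has the same exponent in the field and in its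
   correction, and the two weights agree. *)
rewrite actS_primW decmE.
have j0 : (j == ord0) = false by apply/negbTE; rewrite neq_ltn /= (leq_ltn_trans _ qj) ?orbT.
by rewrite [ord0 == j]eq_sym j0 subn0 sub0r.
Qed.

(** Each field is a multiple of a curl in two indices: d_1 and j for a pivotal pair, j and the pivot
    for a corrected field, j and any k with exponent below p-1 when [e j = 0]. At a corner no such k
    exists, and the curl with d_1 requires g to be a derivative. *)
Lemma embJ_Sn x g : (corner x -> exists h, trunc g = trunc h^`()) -> Sn (embJ x g).
Proof.
case: x => j e; case: (boolP (pivotal (j, e))) => Px cx.
  rewrite (embJ_pivotal _ Px) /=; have /andP[/= pos Pd] := Px; set d := decm j e in Pd *.
  have -> : dW ord0 (P d g) - primW d g^`() = ((d j).+1%:R)^-1 *: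
      curlW ord0 (lift ord0 j) (polyA (incr j (fun k => d k)) g).
    rewrite /primW (pivE Pd) /curlW polyA_der0 // polyA_derS // scalerBr dWZ scalerA.
    rewrite (_ : incr j (fun k => d k) j = (d j).+1); last by rewrite /incr eqxx addn1.
    rewrite mulVf ?scale1r; last by rewrite (natf_neq0 charp) //; case/andP: Pd.
    rewrite (@eq_polyA _ _ _ (decr j _) (fun k => d k)) // => k.
    by rewrite /decr /incr addnK.
  by apply/SnZ/curlW_Sn => //; exact: neq_lift.
rewrite (embJ_nonpivotal _ Px) /=; case: (posnP (e j)) => [e0|pos].
  rewrite e0 scale0r subr0.
  case: (boolP (corner (j, e))) => [/cx[h E]|].
    rewrite (eq_truncp_polyA _ E).
    have -> : dW (lift ord0 j) (P e h^`()) = curlW (lift ord0 j) ord0 (P e h).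
      by rewrite /curlW polyA_der0 // polyA_derS // e0 scale0r [dW _ 0]linear0 subr0.
    by apply: curlW_Sn => //; rewrite eq_sym neq_lift.
  rewrite negb_forall => /existsP[k] /=; case: (eqVneq k j) => [->|kj ne]; first by rewrite e0 eqxx.
  have lt : ((e k).+1 < p)%N by rewrite ltn_neqAle ne ltn_ord.
  have -> : dW (lift ord0 j) (P e g) = ((e k).+1%:R)^-1 *:
      curlW (lift ord0 j) (lift ord0 k) (polyA (incr k (fun k => e k)) g).
    rewrite /curlW !polyA_derS // scalerBr dWZ scalerA.
    rewrite (_ : incr k (fun k => e k) k = (e k).+1); last by rewrite /incr eqxx addn1.
    rewrite (_ : incr k (fun k => e k) j = 0%N); last by rewrite /incr eq_sym (negPf kj) e0.
    rewrite mulVf ?scale1r; last by rewrite (natf_neq0 charp).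
    rewrite scale0r [dW _ 0]linear0 scaler0 subr0.
    rewrite (@eq_polyA _ _ _ (decr k _) (fun k => e k)) // => l.
    by rewrite /decr /incr addnK.
  by apply/SnZ/curlW_Sn => //; rewrite (inj_eq lift_inj) eq_sym.
have [q Pq qj] := nonpivotal_piv Px pos; set d := decm j e in Pq *.
have nqj : (q == j) = false by apply/negbTE; rewrite neq_ltn qj.
have njq : (j == q) = false by rewrite eq_sym.
have dq : d q = e q :> nat by rewrite decmE nqj subn0.
have -> : dW (lift ord0 j) (P e g) - (e j)%:R *: primW d g = ((d q).+1%:R)^-1 *:
    curlW (lift ord0 j) (lift ord0 q) (polyA (incr q (fun k => e k)) g).
  rewrite /primW (pivE Pq) /curlW !polyA_derS // scalerBr !dWZ !scalerA.
  rewrite (_ : incr q (fun k => e k) q = (d q).+1); last by rewrite /incr eqxx addn1 dq.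
  rewrite (_ : incr q (fun k => e k) j = e j); last by rewrite /incr njq addn0.
  rewrite mulVf ?scale1r; last by rewrite (natf_neq0 charp) //; case/andP: Pq.
  rewrite (@eq_polyA _ _ _ (decr q _) (fun k => e k)) => [|k]; last first.
    by rewrite /decr /incr addnK.
  rewrite (@eq_polyA _ _ _ (decr j _) (incr q (fun k => d k))) => [|k]; last first.
    rewrite /decr /incr decmE.
    by case: (eqVneq k j) => [->|_]; rewrite ?njq; lia.
  by rewrite [_^-1 * _]mulrC.
by apply/SnZ/curlW_Sn => //; rewrite (inj_eq lift_inj) njq.
Qed.

(** Corrections occupy the d_j-slots of pivotal pairs. These slots are never read, a pivotal pair
    reading a d_1-slot instead, which makes [coordJ] dual to [embJ]. *)
Definition coordJ x (D : Wn F p n) : T :=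
  if pivotal x then [ffun a => D ord0 (mcons a (decm x.1 x.2))]
  else [ffun a => D (lift ord0 x.1) (mcons a x.2)].

Lemma coordJ_is_linear x : linear (coordJ x).
Proof.
by move=> c D E; rewrite /coordJ; case: ifP => _; apply/ffunP => a; rewrite !ffunE.
Qed.
HB.instance Definition _ x :=
  GRing.isLinear.Build F (Wn F p n) T _ (coordJ x) (coordJ_is_linear x).

Lemma coordJB x D E : coordJ x (D - E) = coordJ x D - coordJ x E.
Proof. exact: linearB. Qed.

Lemma coordJ_sum x (I : Type) (t : seq I) (Q : pred I) (G : I -> Wn F p n) :
  coordJ x (\sum_(i <- t | Q i) G i) = \sum_(i <- t | Q i) coordJ x (G i).
Proof. exact: linear_sum. Qed.

Lemma dW_mcons (i i' : 'I_n) (e : 'I_m -> nat) g a d :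
  dW i (polyA e g) i' (mcons a d) =
  if (i' == i) && [forall k, (d k : nat) == e k] then g`_a else 0.
Proof. by rewrite ffunE; case: eqP => _ /=; [exact: polyA_mcons | rewrite ffunE]. Qed.

Lemma eq_monP e d : reflect (e = d) [forall k, (e k : nat) == d k].
Proof.
apply: (iffP forallP) => [H|-> k //]; apply/ffunP => k; exact/val_inj/eqP/H.
Qed.

Lemma coordJ_primW x d h q : is_piv d q -> coordJ x (primW d h) = 0.
Proof.
move=> Pq; rewrite /primW (pivE Pq) linearZ /=; set c := (X in X *: _).
rewrite (_ : coordJ x _ = 0) ?scaler0 // {c}; apply/ffunP => a.
rewrite /coordJ; case: ifP => [Px|/negbT Px]; rewrite ffunE dW_mcons ffunE //.
rewrite (inj_eq lift_inj); case: eqP => //= xq.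
case: forallP => // H; case/negP: Px.
have [e Pe [E _]] := pivotal_incr Pq.
have Ee : x.2 = e by apply/eq_monP/forallP => k; rewrite (eqP (H k)) E.
by rewrite [x]surjective_pairing Ee xq.
Qed.

Lemma coordJ_embJ x y g : coordJ x (embJ y g) = if x == y then trunc g else 0.
Proof.
case: x y => [j e] [j' e']; rewrite [embJ _ _]/embJ /=; case: ifP => [Py|/negbT Py].
  have /andP[/= pos Pd] := Py.
  rewrite linearB /= (coordJ_primW _ _ Pd) subr0 /coordJ /=.
  apply/ffunP => a; case: ifP => Px; rewrite ffunE dW_mcons /=; last first.
    by case: eqP => [E|_]; rewrite ?ffunE //; rewrite E Py in Px.
  case: eq_monP => E; first by rewrite (pivotal_inj Px Py E) eqxx ffunE.
  by case: eqP => [[ej ee]|_]; [case: E; rewrite ej ee | rewrite ffunE].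
rewrite linearB linearZ /= (_ : (e' j')%:R *: _ = 0) ?subr0; last first.
  case: (posnP (e' j')) => [->|pos]; first by rewrite scale0r.
  by have [q Pq _] := nonpivotal_piv Py pos; rewrite (coordJ_primW _ _ Pq) scaler0.
rewrite /coordJ /=; apply/ffunP => a; case: ifP => Px; rewrite ffunE dW_mcons /=.
  by case: eqP => [E|_]; rewrite ?ffunE //; rewrite -E Px in Py.
rewrite (inj_eq lift_inj) xpair_eqE; case: eqP => //= _; last by rewrite ffunE.
by case: eq_monP => [->|ne]; [rewrite eqxx ffunE | case: eqP => // _; rewrite ffunE].
Qed.

(** Two kinds of slots escape the coordinates: the d_1-slot in the degree with all exponents p-1,
    covered by the top condition, and the d_j-slots of pivotal pairs, which the divergence
    determines. *)
Lemma coordJ_eq0 (D : Wn F p n) : divW D = 0 ->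
  (forall (i : 'I_n) (ga : mon p n), (forall k, k != i -> (ga k).+1 = p) -> D i ga = 0) ->
  (forall x, coordJ x D = 0) -> D = 0.
Proof.
move=> dD top cD.
have nonpiv j e a : ~~ pivotal (j, e) -> D (lift ord0 j) (mcons a e) = 0.
  move=> Px; have /ffunP/(_ a) := cD (j, e).
  by rewrite /coordJ (negPf Px) !ffunE.
have D0 a d : D ord0 (mcons a d) = 0.
  case: (boolP [exists k, (d k).+1 < p]%N) => [/existsP[k lt]|].
    have [q Pq _] := is_piv_ex lt; have [e Pe [_ E]] := pivotal_incr Pq.
    by have /ffunP/(_ a) := cD (q, e); rewrite /coordJ Pe !ffunE /= E.
  rewrite negb_exists => /forallP H; apply: top => k.
  case: (unliftP ord0 k) => [l|] -> // _; rewrite mconsS.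
  by apply/eqP; rewrite eqn_leq ltn_ord leqNgt H.
have DS j e a : D (lift ord0 j) (mcons a e) = 0.
  case: (boolP (pivotal (j, e))) => [Px|]; last exact: nonpiv.
  have /andP[/= pos Pd] := Px; set d := decm j e in Pd.
  (* Only one pivotal pair contributes to this coefficient of the divergence, because [d] has a
     unique pivot; the other terms are already known to vanish. *)
  have := congr1 (fun f : Alg F p n => f (mcons a d)) dD; rewrite ffunE sum_ffunE.
  rewrite (bigD1 (lift ord0 j)) //= [X in _ + X]big1 ?addr0; last first.
    move=> i ij; rewrite ffunE big1 // => al _; case: ifP => // /andP[/eqP E1 /forallP E2].
    elim/monS_ind: al E1 E2 => b e' E1 E2.
    case: (unliftP ord0 i) ij E1 E2 => [l|] -> ij E1 E2; last by rewrite D0 mulr0.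
    rewrite nonpiv ?mulr0 //; move: ij; rewrite (inj_eq lift_inj); apply: contra => Pl.
    rewrite !mconsS in E1.
    have Ed : decm l e' = d.
      apply/ffunP => k; apply/val_inj; rewrite /= decmE; case: (eqVneq k l) => [->|kl].
        by rewrite E1 subn1.
      have := E2 (lift ord0 k); rewrite (inj_eq lift_inj) kl !mconsS subn0 => /eqP->.
      by [].
    by move: Pl => /andP[_ /=]; rewrite Ed => /is_piv_uniq/(_ Pd)->.
  rewrite (@derAE _ _ _ _ _ _ (mcons a e)).
  - move/eqP; rewrite mulf_eq0 mconsS decmE eqxx subn1 prednK // (negPf (natf_neq0 charp _)) //=.
      by move/eqP.
    by rewrite pos ltn_ord.
  - by rewrite !mconsS decmE eqxx subn1 prednK.
  - move=> k; case: (unliftP ord0 k) => [l|] ->; last by rewrite !mcons0.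
    rewrite (inj_eq lift_inj) !mconsS => ne; apply/val_inj.
    by rewrite /= decmE (negPf ne) subn0.
apply/ffunP => i; apply/ffunP => al; rewrite !ffunE; elim/monS_ind: al => a e.
by case: (unliftP ord0 i) => [j|] ->.
Qed.

Lemma coordJ_exact x (D : Wn F p n) : corner x -> Sn D -> exactT (coordJ x D).
Proof.
move=> cx SD; apply/(exactTP charp) => i Ei.
rewrite /coordJ (negPf (corner_nonpivotal cx)) ffunE.
apply: (Sn_top charp SD) => k; case: (unliftP ord0 k) => [l|] ->; last by rewrite mcons0.
rewrite (inj_eq lift_inj) mconsS => ne; have /forallP/(_ l) := cx.
by rewrite (negPf ne) => /eqP.
Qed.

(** The remainder has zero coordinates and lies in S(n), by exactness of the corner coordinates, so
    both conditions of [coordJ_eq0] hold for it. *)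
Lemma Sn_coordJ (D : Wn F p n) : Sn D -> D = \sum_x embJ x (liftp (coordJ x D)).
Proof.
move=> SD; apply/eqP; rewrite -subr_eq0; apply/eqP.
have SR : Sn (D - \sum_x embJ x (liftp (coordJ x D))).
  rewrite addrC -scaleN1r; apply: SnP => //; apply: Sn_sum => x _; apply: embJ_Sn => cx.
  have [h E] := coordJ_exact cx SD.
  by exists h; rewrite liftpK.
apply: coordJ_eq0; first exact: Sn_divW.
  by move=> i ga; exact: Sn_top.
move=> x; rewrite coordJB coordJ_sum.
have E y : coordJ x (embJ y (liftp (coordJ y D))) = if x == y then coordJ y D else 0.
  by rewrite coordJ_embJ liftpK.
by rewrite (eq_bigr _ (fun y _ => E y)) big_delta subrr.
Qed.

End Decomposition.

(** * Multiplicities of the weights *)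

Section Counting.
Variables (p r : nat).
Hypothesis p_gt1 : (1 < p)%N.
Local Notation m := r.+1.
Local Notation J := ('I_m * mon p m)%type.
Implicit Types (x : J) (j : 'I_m) (e : mon p m).

Let p_gt0 : (0 < p)%N. Proof. exact: ltnW. Qed.
Let zerop : 'I_p := Ordinal p_gt0.
Let topp : 'I_p := Ordinal (eq_ind_r (fun k => (p.-1 < k)%N) (ltnSn p.-1) (esym (prednK p_gt0))).

(* The density weight of a summand, as a representative in [0, p-1]. *)
Definition weight x : nat :=
  if x.1 == ord0 then (if x.2 ord0 == 0 :> nat then 1 else p - x.2 ord0)%N
  else if (x.2 ord0 == 0 :> nat) || pivotal x then 0%N else (p - x.2 ord0)%N.

Lemma pivotal_first e : pivotal (ord0, e) = (0 < e ord0)%N.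
Proof.
rewrite pivotalE; case: (0 < e ord0)%N => //=; exact/forallP.
Qed.

Lemma pivotal_lower j e : pivotal (j, e) -> j != ord0 -> (e ord0).+1 = p.
Proof.
rewrite pivotalE => /andP[_ /forallP/(_ ord0)] H j0; apply/eqP; move: H.
by rewrite lt0n (_ : (j : nat) != 0%N).
Qed.

Lemma weight_corner x : corner x -> weight x = 1%N.
Proof.
move=> cx; have := corner_nonpivotal cx; have /forallP/(_ ord0) := cx; rewrite /weight.
case: x cx => j e _ /=; case: (eqVneq ord0 j) => [<- ->//|j0 /eqP E /negPf->].
rewrite orbF (_ : (e ord0 == 0 :> nat) = false); first lia.
by apply/negbTE; lia.
Qed.

Lemma weight_lt x : (weight x < p)%N.
Proof.
rewrite /weight; case: x => j e /=; have := ltn_ord (e ord0).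
by repeat case: ifP => //; move=> *; lia.
Qed.

(** Corners have weight 1; they are set apart by the label p, which no weight attains. *)
Definition class x : nat := if corner x then p else weight x.

Lemma class_weight x c : (c < p)%N -> c != 1%N -> (class x == c) = (weight x == c).
Proof.
move=> cp c1; rewrite /class; case: ifP => // cx.
by rewrite (weight_corner cx) eq_sym (ltn_eqF cp) eq_sym (negPf c1).
Qed.

Lemma card_mon k : #|{: mon p k}| = (p ^ k)%N.
Proof. by rewrite card_ffun !card_ord. Qed.

Lemma card_mon_head (c : 'I_p) : #|[set e : mon p m | e ord0 == c]| = (p ^ r)%N.
Proof.
have -> : [set e : mon p m | e ord0 == c] = [set mcons c e | e in {: mon p r}].
  apply/setP => e; rewrite inE; apply/eqP/imsetP => [E|[e' _ ->]]; last by rewrite mcons0.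
  by elim/monS_ind: e E => a e'; rewrite mcons0 => ->; exists e'.
rewrite card_imset ?card_mon // => e e' E; apply/ffunP => k.
by have := congr1 (fun e : mon p m => e (lift ord0 k)) E; rewrite !mconsS.
Qed.

Lemma card_class_top : #|[set x | class x == p]| = m.
Proof.
pose ce j : J := (j, [ffun k => if k == j then zerop else topp]).
have -> : [set x | class x == p] = [set ce j | j in 'I_m].
  apply/setP => x; rewrite inE /class; apply/eqP/imsetP => [|[j _ ->]].
    case: ifP => [cx _|_ E]; last by have := weight_lt x; rewrite E ltnn.
    exists x.1 => //; rewrite [LHS]surjective_pairing; congr pair; apply/ffunP => k.
    rewrite ffunE; have /forallP/(_ k) := cx; case: eqP => _ /eqP E; apply/val_inj => //=.
    by lia.
  rewrite (_ : corner _) //; apply/forallP => k /=; rewrite ffunE.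
  by case: eqP => //= _; rewrite prednK.
by rewrite card_imset ?card_ord // => j j' [].
Qed.

(** For every j the weight c is attained at the single x_2-exponent p-c: pivotal pairs with j other
    than x_2 have weight 0 and do not interfere. *)
Lemma card_class_mid c : (1 < c < p)%N -> #|[set x | class x == c]| = (m * p ^ r)%N.
Proof.
move=> /andP[c1 cp]; have lt : (p - c < p)%N by lia.
have -> : [set x | class x == c] = setX [set: 'I_m] [set e : mon p m | e ord0 == Ordinal lt].
  apply/setP => -[j e]; rewrite !inE class_weight //; last lia.
  rewrite /= -(inj_eq val_inj) /weight /=; move: (@pivotal_lower j e) (ltn_ord (e ord0)).
  move: (nat_of_ord (e ord0)) => a pl ap; case: (eqVneq j ord0) => [_|j0].
    by case: (eqVneq a 0%N) => ?; apply/eqP/eqP; lia.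
  case: (eqVneq a 0%N) => ? /=; first by apply/eqP/eqP; lia.
  by case: ifP => [/pl/(_ j0) ?|_]; apply/eqP/eqP; lia.
by rewrite cardsX card_mon_head cardsT card_ord.
Qed.

(** Lowering e at j is a bijection onto the degrees with x_2-exponent p-1 that have a pivot, that
    is, all but the one with every exponent p-1. *)
Lemma card_pivotal_lower :
  #|[set x : J | (x.1 != ord0) && pivotal x]| = (p ^ r - 1)%N.
Proof.
pose tau : mon p m := [ffun=> topp].
have [dinj dim] : {in [set x : J | (x.1 != ord0) && pivotal x] &, injective (fun x : J => decm x.1 x.2)}
    /\ (fun x : J => decm x.1 x.2) @: [set x : J | (x.1 != ord0) && pivotal x] =
       [set e : mon p m | e ord0 == topp] :\ tau.
  split.
    move=> [j e] [j' e']; rewrite !inE /= => /andP[_ P1] /andP[_ P2]; exact: pivotal_inj.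
  apply/setP => d; rewrite !inE; apply/imsetP/andP => [[[j e]]|[/eqP dt /eqP d0]].
    rewrite inE /= => /andP[j0 Px] ->; have E := pivotal_lower Px j0.
    have /andP[/= pos /andP[lt _]] := Px; split.
      apply/negP => /eqP Et; move: lt; rewrite Et ffunE /= prednK // ltnn //.
    by apply/eqP/val_inj; rewrite /= decmE eq_sym (negPf j0) subn0; lia.
  have [k lt] : exists k, ((d k).+1 < p)%N.
    apply/existsP; apply: contra_notT dt; rewrite negb_exists => /forallP H.
    apply/ffunP => k; apply/val_inj; rewrite ffunE /=.
    by move: (H k) (ltn_ord (d k)); move: (nat_of_ord (d k)) => a; lia.
  have [q Pq _] := is_piv_ex lt; have [e Pe [_ Ed]] := pivotal_incr Pq.
  exists (q, e) => //=; rewrite inE /= Pe andbT; apply/negP => /eqP q0.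
  by move: Pq; rewrite q0 /is_piv d0 /= prednK // ltnn.
rewrite -(card_in_imset dinj) dim; have := cardsD1 tau [set e : mon p m | e ord0 == topp].
by rewrite card_mon_head inE ffunE eqxx => ->; rewrite add1n subn1.
Qed.

Lemma card_class_0 : #|[set x | class x == 0]| = (m * p ^ r - 1)%N.
Proof.
have -> : [set x | class x == 0] =
    setX [set~ ord0] [set e : mon p m | e ord0 == zerop] :|:
    [set x : J | (x.1 != ord0) && pivotal x].
  apply/setP => -[j e]; rewrite !inE class_weight //= /weight /=.
  have -> : (e ord0 == zerop) = (nat_of_ord (e ord0) == 0%N) by [].
  move: (ltn_ord (e ord0)); move: (nat_of_ord (e ord0)) => a ap.
  case: (eqVneq j ord0) => _ /=; first by case: (eqVneq a 0%N) => ? //; apply/negbTE; lia.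
  by case: (eqVneq a 0%N) => //= ?; case: ifP => //= _; apply/negbTE; lia.
rewrite cardsU cardsX card_pivotal_lower card_mon_head cardsC1 card_ord /=.
rewrite (_ : _ :&: _ = set0) ?cards0; last first.
  apply/setP => -[j e]; rewrite !inE /=; apply/negbTE; apply/negP.
  move=> /andP[/andP[_ /eqP e0] /andP[j0 Px]].
  by have := pivotal_lower Px j0; rewrite e0 /=; lia.
have : (0 < p ^ r)%N by rewrite expn_gt0 p_gt0.
by rewrite mulSn; lia.
Qed.

(** Weight 1 collects several kinds of pairs, so its class is found by subtracting the others from
    the total m p^m. *)
Lemma card_class_1 : #|[set x | class x == 1]| = (m * (p ^ r - 1) + 1)%N.
Proof.
have tot : (\sum_(c < p.+1) #|[set x | class x == c]| = m * p ^ m)%N.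
  have -> : (m * p ^ m)%N = #|{: J}| by rewrite card_prod card_ord card_mon.
  rewrite -[RHS]sum1_card.
  rewrite [RHS](partition_big (fun x : J => inord (class x) : 'I_p.+1) xpredT) //=.
  apply: eq_bigr => c _; rewrite -sum1dep_card; apply: eq_bigl => x.
  rewrite -(inj_eq val_inj) /= inordK // /class; case: ifP => // _.
  exact: ltnW (weight_lt x).
rewrite -(big_mkord xpredT (fun c => #|[set x | class x == c]|)) in tot.
rewrite big_nat_recr //= card_class_top in tot.
rewrite (@big_ltn _ _ _ 0%N) // card_class_0 (@big_ltn _ _ _ 1%N) // in tot.
rewrite (eq_big_nat _ _ (F2 := fun=> (m * p ^ r)%N)) in tot; last first.
  by move=> c lt; rewrite card_class_mid.
rewrite sum_nat_const_nat in tot.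
have pr : (0 < p ^ r)%N by rewrite expn_gt0 p_gt0.
move: tot; set c1 := #|_|; rewrite expnS; move: (p ^ r)%N pr => N N0 tot.
have Ep : p = (p - 2).+2 by lia.
move: tot; rewrite {2}Ep; move: (p - 2)%N => q; nia.
Qed.

(** The map enumerates the fibres of [class]; it is injective, and comparing cardinalities makes it
    bijective. *)
Lemma class_bij (a b c l : nat) :
  a = (m * (p ^ r - 1) + 1)%N -> b = (m * p ^ r - 1)%N -> c = (m * p ^ r)%N -> l = m ->
  exists2 h : 'I_a + 'I_b + ('I_(p - 2) * 'I_c) + 'I_l -> J, bijective h &
  [/\ forall k, class (h (inl (inl (inl k)))) = 1%N,
      forall k, class (h (inl (inl (inr k)))) = 0%N,
      forall i k, class (h (inl (inr (i, k)))) = i.+2 &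
      forall k, class (h (inr k)) = p].
Proof.
move=> Ea Eb Ec El.
pose pickc (t N : nat) (E : N = #|[set x | class x == t]|) (k : 'I_N) : J :=
  enum_val (cast_ord E k).
have pickcP t N E k : class (@pickc t N E k) = t.
  by have := enum_valP (cast_ord E k); rewrite inE => /eqP.
have pickcI t N E : injective (@pickc t N E).
  by move=> k k' /enum_val_inj /cast_ord_inj.
have E1 : a = #|[set x | class x == 1%N]| by rewrite card_class_1.
have E0 : b = #|[set x | class x == 0%N]| by rewrite card_class_0.
have E2 (i : 'I_(p - 2)) : c = #|[set x | class x == i.+2]|.
  by rewrite card_class_mid //; have := ltn_ord i; lia.
have Ep : l = #|[set x | class x == p]| by rewrite card_class_top.
pose h (t : 'I_a + 'I_b + ('I_(p - 2) * 'I_c) + 'I_l) : J :=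
  match t with
  | inl (inl (inl k)) => pickc _ _ E1 k
  | inl (inl (inr k)) => pickc _ _ E0 k
  | inl (inr ik) => pickc _ _ (E2 ik.1) ik.2
  | inr k => pickc _ _ Ep k
  end.
exists h; last by split=> *; rewrite /h pickcP.
apply: inj_card_bij.
  move=> t t' E; have := congr1 class E.
  case: t E => [[[k|k]|[i k]]|k]; case: t' => [[[k'|k']|[i' k']]|k'] /= E;
    rewrite !pickcP //= => C; try by [have := ltn_ord i; lia | have := ltn_ord i'; lia | lia].
  - by rewrite (pickcI _ _ _ _ _ E).
  - by rewrite (pickcI _ _ _ _ _ E).
  - have Ei : i = i' by apply/val_inj; case: C.
    by move: E; rewrite Ei => /pickcI->.
  - by rewrite (pickcI _ _ _ _ _ E).
rewrite card_prod card_mon !card_sum card_prod !card_ord Ea Eb Ec El expnS.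
have pr : (0 < p ^ r)%N by rewrite expn_gt0 p_gt0.
move: (p ^ r)%N pr => N N0; have Ep2 : p = (p - 2).+2 by lia.
rewrite {1}Ep2; move: (p - 2)%N => q; nia.
Qed.

End Counting.

(** * Isomorphism types of the summands *)

Section Summands.
Variables (F : fieldType) (p r : nat).
Hypothesis charp : p \in [pchar F].
Local Notation m := r.+1.
Local Notation n := r.+2.
Local Notation T := {ffun 'I_p -> F^o}.
Local Notation J := ('I_m * mon p m)%type.
Implicit Types (x : J) (v : T).

Let p_gt1 : (1 < p)%N. Proof. exact: prime_gt1 (pcharf_prime charp). Qed.

Lemma wtJ_weight x : wtJ F x = (weight x)%:R.
Proof.
have pB a : (a <= p)%N -> (p - a)%:R = - a%:R :> F.
  by move=> le; rewrite natrB // pcharf0 // sub0r.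
case: x => j e; rewrite /wtJ /weight /=; have lt := ltnW (ltn_ord (e ord0)).
case: (eqVneq j ord0) => [->|j0].
  rewrite pivotal_first decmE eqxx subn1; case: (posnP (e ord0)) => [->|pos].
    by rewrite /= subr0.
  by rewrite pB // -{2}(prednK pos) -natr1 opprD addrC.
case: ifP => [Px|_].
  (* Here x_2 has exponent p-1, so the weight -1-(p-1) is 0 in [F]. *)
  rewrite orbT decmE eq_sym (negPf j0) subn0 -opprD addrC natr1.
  by rewrite (pivotal_lower Px j0) pcharf0 // oppr0.
rewrite orbF sub0r; case: eqP => [->|_]; first by rewrite oppr0.
by rewrite pB.
Qed.

Definition iotaJ x v : Wn F p n := embJ x (liftp v).

Definition summand x : Wn F p n -> Prop :=
  image_of (iotaJ x) (if corner x then @exactT F p else fun _ => True).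

Lemma iotaJ_linear x : linear (iotaJ x).
Proof. by move=> c u v; rewrite /iotaJ liftp_is_linear embJ_is_linear. Qed.

Lemma iotaJK x : cancel (iotaJ x) (coordJ x).
Proof. by move=> v; rewrite coordJ_embJ eqxx liftpK. Qed.

Lemma iotaJA x D v : actS D (iotaJ x v) = iotaJ x (actT (wtJ F x) D v).
Proof.
rewrite /iotaJ -{1}[D]witt_polyK (actS_embJ charp); apply: (embJ_truncp charp).
by rewrite liftpK.
Qed.

Lemma summand_Sn x D : summand x D -> Sn D.
Proof.
move=> [v vP ->]; apply: embJ_Sn => // cx; rewrite cx in vP.
by have [h E] := vP; exists h; rewrite liftpK.
Qed.

Lemma summand_coordJ x D : Sn D -> summand x (iotaJ x (coordJ x D)).
Proof.
move=> SD; exists (coordJ x D) => //; case: ifP => // cx; exact: coordJ_exact.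
Qed.

Lemma summandE x D : summand x D -> D = iotaJ x (coordJ x D).
Proof. by move=> [v _ ->]; rewrite iotaJK. Qed.

Lemma summand_span D : Sn D -> D = \sum_x iotaJ x (coordJ x D).
Proof. exact: Sn_coordJ. Qed.

Lemma summand_indep (u : J -> Wn F p n) : (forall x, summand x (u x)) ->
  \sum_x u x = 0 -> forall x, u x = 0.
Proof.
move=> Uu u0 x.
have E y : coordJ x (u y) = if x == y then coordJ y (u y) else 0.
  by rewrite {1}(summandE (Uu y)) coordJ_embJ liftpK.
have := coordJ_sum x (index_enum _) xpredT u.
rewrite (eq_bigr _ (fun y _ => E y)) big_delta u0 => C.
by rewrite (summandE (Uu x)) -C /iotaJ [coordJ _ 0]linear0 [liftp 0]linear0 [embJ _ 0]linear0.
Qed.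

(** Reduction modulo p treats V(0), of class 1, and V(p-1), of class 0, at once. *)
Lemma summand_verma x lam : class x = (lam.+1 %% p)%N ->
  verma_sub lam (@actS F p n) (summand x).
Proof.
rewrite /class /summand; case: ifP => [_ E|_ E].
  by have := ltn_pmod lam.+1 (ltnW p_gt1); rewrite -E ltnn.
apply: (image_verma charp (iotaJ_linear x) (coordJ_is_linear x) (iotaJK x) (iotaJA x) (wtJ_weight x)).
by rewrite wtJ_weight E [in RHS](divn_eq lam.+1 p) natrD natrM (pcharf0 charp) mulr0 add0r.
Qed.

Lemma summand_simpleL x lam : (0 < lam)%N -> (lam.+1 < p)%N -> class x = lam.+1 ->
  simpleL_sub lam (@actS F p n) (summand x).
Proof.
move=> l0 lp; rewrite /class /summand; case: ifP => [_ E|_ E].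
  by move: lp; rewrite -E ltnn.
have sE : wtJ F x = lam.+1%:R by rewrite wtJ_weight E.
have s0 : lam.+1%:R != 0 :> F by rewrite (natf_neq0 charp).
have s1 : lam.+1%:R != 1 :> F.
  by rewrite -subr_eq0 -natr1 addrK (natf_neq0 charp) // l0 ltnW.
(* T_(lam+1) is both V(lam) and simple, so the quotient map is the identity. *)
apply: (@image_simpleL _ _ _ _ charp _ _ _ (iotaJ_linear x) (iotaJK x) (iotaJA x) _ sE lam _ id).
- by rewrite sE; apply: simple_actT => //; lia.
- by rewrite sE; split.
- by move=> v; split=> // _; exists v.
Qed.

Lemma summand_corner x : class x = p -> simpleL_sub (p - 1) (@actS F p n) (summand x).
Proof.
rewrite /class /summand; case: ifP => [cx _|_ E]; last first.
  by have := weight_lt p_gt1 x; rewrite E ltnn.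
have sE : wtJ F x = 1%:R by rewrite wtJ_weight weight_corner.
(* The quotient map is d/dx from T_0 to T_1; the source is T_0 because (p-1)+1 = 0 in [F]. *)
apply: (@image_simpleL _ _ _ _ charp _ _ _ (iotaJ_linear x) (iotaJK x) (iotaJA x) _ sE (p - 1) _
          (fun v => truncp p (liftp v)^`())).
- by rewrite sE; exact: simple_exactT.
- rewrite sE subn1 prednK ?(ltnW p_gt1) // pcharf0 //; split=> [a u u' _ _|D u _].
    by rewrite liftp_is_linear derivD derivZ truncp_is_linear.
  rewrite /actT (truncp_deriv charp (liftpK _)).
  rewrite (rho_truncp charp _ (erefl _) (liftpK (truncp p _))).
  congr truncp; rewrite /rho !(derivD, derivZ, derivM) -!mul_polyC; ring.
- move=> v; split=> [[g ->]|[y ->]]; last by exists (liftp y).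
  by exists (truncp p g); apply: truncp_deriv => //; rewrite liftpK.
Qed.

End Summands.

Theorem theorem4p7 (F : closedFieldType) (p n : nat) :
  prime p -> (2 < p)%N -> p \in [pchar F] -> (2 <= n)%N ->
  exists U : ('I_((n - 1) * (p ^ (n - 2) - 1) + 1)
              + 'I_((n - 1) * p ^ (n - 2) - 1)
              + ('I_(p - 2) * 'I_((n - 1) * p ^ (n - 2)))
              + 'I_(n - 1))%type -> Wn F p n -> Prop,
    (* the summands lie in S(n), span it, and their sum is direct *)
    (forall j D, U j D -> Sn D) /\
    (forall D, Sn D -> exists u, (forall j, U j (u j)) /\ D = \sum_j u j) /\
    (forall u, (forall j, U j (u j)) -> \sum_j u j = 0 -> forall j, u j = 0) /\
    (* isomorphism types of the summands, as W(1)-modules via actS *)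
    (forall k, verma_sub 0 (@actS F p n) (U (inl (inl (inl k))))) /\
    (forall k, verma_sub (p - 1) (@actS F p n) (U (inl (inl (inr k))))) /\
    (forall (i : 'I_(p - 2)) k, simpleL_sub i.+1 (@actS F p n) (U (inl (inr (i, k))))) /\
    (forall k, simpleL_sub (p - 1) (@actS F p n) (U (inr k))).
Proof.
move=> _ p2 charp; case: n => [|[|r]] // _.
have p1 : (1 < p)%N by exact: ltnW.
rewrite [(r.+2 - 1)%N]subn1 [(r.+2 - 2)%N]subn2 /=.
have [h hbij [h1 h0 h2 hp]] := @class_bij p r p1 _ _ _ _ (erefl _) (erefl _) (erefl _) (erefl _).
have [h' hK h'K] := hbij.
exists (fun t => @summand F p r (h t)); split; first by move=> t D; exact: summand_Sn.
split.
  move=> D SD; exists (fun t => iotaJ (h t) (coordJ (h t) D)).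
  split=> [t|]; first exact: summand_coordJ.
  rewrite {1}(summand_span charp SD); apply: reindex; exact: onW_bij.
split.
  move=> u Uu u0 t.
  have Uu' x : @summand F p r x (u (h' x)) by rewrite -{1}[x]h'K.
  have := summand_indep Uu' _ (h t); rewrite hK; apply.
  by rewrite (reindex h) /=; [under eq_bigr do rewrite hK | exact: onW_bij].
split; first by move=> k; apply: summand_verma; rewrite // h1 modn_small.
split; first by move=> k; apply: summand_verma; rewrite // h0 subn1 prednK ?modnn // ltnW.
split; last by move=> k; apply: summand_corner; rewrite // hp.
by move=> i k; apply: summand_simpleL; rewrite // ?h2 //; have := ltn_ord i; lia.
Qed.
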